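(* Let $k$ be an algebraically closed field with $\mathrm{char}(k)=0$, let $\Gamma$ be a (connected) Brauer graph with vertices $x_1,\dots,x_r$ of multiplicities $m_1,\dots,m_r$, and let $A=A_\Gamma$ be its Brauer graph algebra. Then the projective center $Z^{\mathrm{pr}}(A)$ is the $k$-subspace of the center $Z(A)$ spanned by $p_{1,1}^{m_1},p_{2,1}^{m_2},\dots,p_{r,1}^{m_r}$.
   Context: Brauer graphs. A ribbon graph is a tuple $\Gamma=(V,H,r,\iota,\rho)$ with $V$ (vertices) and $H$ (half-edges) finite sets, $r:H\to V$ a function, $\iota:H\to H$ an involution without fixed points, and $\rho:H\to H$ a permutation whose cycles are exactly the sets $H_v=r^{-1}(v)$, $v\in V$. Its edges are the $\iota$-orbits $\bar h=\{h,\iota(h)\}$, with $\bar h$ incident to $r(h)$ and $r(\iota(h))$; the underlying graph is assumed connected. The valency of $v$ is $val(v)=|H_v|$. A Brauer graph is a ribbon graph together with a multiplicity function $m:V\to\mathbb{Z}_{>0}$. A vertex $v$ is truncated if $m(v)\,val(v)=1$. Brauer graph algebras. Paths are written from right to left; $s(p),t(p)$ denote source and terminus of a path. If $\Gamma$ is a single edge with two truncated vertices, then $A_\Gamma=k[\alpha]/(\alpha^2)$ (with $\sigma(\alpha)=\alpha$, $C_\alpha=\alpha$, $m(C_\alpha)=1$). Otherwise $A_\Gamma=kQ_\Gamma/I_\Gamma$, where the vertices of $Q_\Gamma$ are the edges of $\Gamma$, and for each $h\in H$ with $r(h)$ not truncated there is an arrow $\alpha_h:\bar h\to\overline{\rho(h)}$.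 Put $\sigma(\alpha_h)=\alpha_{\rho^{-1}(h)}$, $C_\alpha=\alpha\sigma(\alpha)\cdots\sigma^{l}(\alpha)$ where $l+1$ is the size of the $\sigma$-orbit of $\alpha$, and $m(C_{\alpha_h})=m(r(h))$. $I_\Gamma$ is generated by: (a) $C_\alpha^{m(C_\alpha)}-C_\beta^{m(C_\beta)}$ for arrows with $t(\alpha)=t(\beta)$; (b) $\alpha C_{\sigma(\alpha)}^{m(C_\alpha)}$ for all arrows $\alpha$; (c) $\alpha\beta$ for composable arrows with $\beta\neq\sigma(\alpha)$. Elements. For a vertex $v$ of $Q_\Gamma$, $s_v=C_\alpha^{m(C_\alpha)}$ for any arrow $\alpha$ with $t(\alpha)=v$ (independent of the choice). For a non-truncated vertex $x_i$ of $\Gamma$, $p_{i,1}=\sum_{h\in H_{x_i}}C_{\alpha_h}$, the sum of all cyclic rotations of the cycle around $x_i$. If $x_i$ is truncated (so $m_i=1$), $p_{i,1}^{m_i}$ is understood to be $s_v$, where $v$ is the vertex of $Q_\Gamma$ corresponding to the unique edge of $\Gamma$ incident to $x_i$. Centers. $Z(A)\cong\operatorname{End}_{A^e}(A)$ with $A^e=A\otimes_kA^{op}$; $Z^{\mathrm{pr}}(A)$ is the ideal of $Z(A)$ corresponding to those $A^e$-endomorphisms of $A$ that factor through a projective $A^e$-module. *)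

(* Defs.v *)
From HB Require Import structures.
From mathcomp Require Import all_boot all_order all_fingroup all_algebra.
From mathcomp Require Import finmap boolp.
From mathcomp.multinomials Require Import monalg.

Set Implicit Arguments.
Unset Strict Implicit.
Unset Printing Implicit Defensive.

Import GRing.Theory.

Local Open Scope ring_scope.

HB.lock Definition lin_ext (k : fieldType) (K : choiceType) (V : lmodType k)
  (f : K -> V) (u : {malg k[K]}) : V := \sum_(x <- msupp u) u@_x *: f x.

Section LinearExtension.
Variables (k : fieldType) (K : choiceType) (V : lmodType k).
Implicit Types (f : K -> V) (u v : {malg k[K]}).

Lemma lin_extEw f u (d : {fset K}) : (msupp u `<=` d)%fset ->
  lin_ext f u = \sum_(x <- d) u@_x *: f x.
Proof.
move=> sud; rewrite lin_ext.unlock (big_fset_incl _ sud) // => x _ xNu.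
by rewrite mcoeff_outdom // scale0r.
Qed.

Lemma lin_ext_is_linear f : linear (lin_ext f).
Proof.
move=> c u v; pose d := (msupp u `|` msupp v)%fset.
have su : (msupp u `<=` d)%fset by exact: fsubsetUl.
have sv : (msupp v `<=` d)%fset by exact: fsubsetUr.
have suv : (msupp (c *: u + v) `<=` d)%fset.
  apply: (fsubset_trans (msuppD_le _ _)).
  by apply: fsetUSS => //; exact: msuppZ_le.
rewrite (lin_extEw _ su) (lin_extEw _ sv) (lin_extEw _ suv).
rewrite scaler_sumr -big_split /=; apply: eq_bigr => x _.
by rewrite mcoeffD mcoeffZ scalerDl scalerA.
Qed.
HB.instance Definition _ f :=
  GRing.isLinear.Build k {malg k[K]} V _ (lin_ext f) (lin_ext_is_linear f).

Lemma eq_lin_ext f g : f =1 g -> lin_ext f =1 lin_ext g.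
Proof.
by move=> fg u; rewrite !lin_ext.unlock; apply: eq_bigr => x _; rewrite fg.
Qed.

Lemma lin_ext_fun_linear c f g u :
  lin_ext (fun x => c *: f x + g x) u = c *: lin_ext f u + lin_ext g u.
Proof.
rewrite !lin_ext.unlock scaler_sumr -big_split /=; apply: eq_bigr => x _.
by rewrite scalerDr !scalerA mulrC.
Qed.

Lemma lin_extU f x : lin_ext f << x >> = f x.
Proof. by rewrite (lin_extEw _ msuppU_le) big_seq_fset1 mcoeffUU scale1r. Qed.

Lemma malgUZ (c : k) (x : K) : << c *g x >> = c *: << x >> :> {malg k[K]}.
Proof. by apply/malgP => y; rewrite mcoeffZ !mcoeffU mulrnAr mulr1. Qed.

Lemma eq_linear_malg (F G : {linear {malg k[K]} -> V}) :
  (forall x, F << x >> = G << x >>) -> F =1 G.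
Proof.
move=> eqFG u; rewrite [u]monalgE !linear_sum; apply: eq_bigr => x _.
by rewrite malgUZ !linearZ eqFG.
Qed.

End LinearExtension.

(* A small category with finitely many objects; [comp x y] is "x after y",
   defined exactly when the source of x is the target of y. *)
Record fin_cat := FinCat {
  ob : finType;
  mor : choiceType;
  cod : mor -> ob;
  dom : mor -> ob;
  idm : ob -> mor;
  comp : mor -> mor -> option mor;
  ob_inh : (0 < #|ob|)%N;
  comp_def : forall x y, isSome (comp x y) = (dom x == cod y);
  comp_idl : forall v x, comp (idm v) x = if v == cod x then Some x else None;
  comp_idr : forall v x, comp x (idm v) = if v == dom x then Some x else None;
  compA : forall x y z, obind (comp x) (comp y z) = obind (comp^~ z) (comp x y)
}.

(* The category algebra: k-linear combinations of morphisms, the product of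
   non-composable morphisms being 0. *)
Definition cat_alg (k : fieldType) (C : fin_cat) : Type := {malg k[mor C]}.

HB.instance Definition _ (k : fieldType) (C : fin_cat) :=
  GRing.Lmodule.on (cat_alg k C).

HB.lock Definition cat_mor (k : fieldType) (C : fin_cat) (x : mor C)
    : cat_alg k C :=
  << x >>.
Definition cat_omor (k : fieldType) (C : fin_cat) (o : option (mor C))
    : cat_alg k C :=
  oapp (cat_mor k (C := C)) 0 o.
HB.lock Definition cat_one (k : fieldType) (C : fin_cat) : cat_alg k C :=
  \sum_v cat_mor k (idm v).
HB.lock Definition cat_mul (k : fieldType) (C : fin_cat) (a b : cat_alg k C)
    : cat_alg k C :=
  lin_ext (fun x => lin_ext (fun y => cat_omor k (comp x y)) b) a.

Section CategoryRing.
Variables (k : fieldType) (C : fin_cat).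
Local Notation A := (cat_alg k C).
Local Notation cat_mor := (@cat_mor k C).
Local Notation cat_omor := (@cat_omor k C).
Local Notation cat_one := (@cat_one k C).
Local Notation cat_mul := (@cat_mul k C).

Lemma lin_ext_mor (V : lmodType k) (f : mor C -> V) x :
  lin_ext f (cat_mor x) = f x.
Proof. by rewrite cat_mor.unlock lin_extU. Qed.

Lemma eq_linear_cat (V : lmodType k) (F G : {linear A -> V}) :
  (forall x, F (cat_mor x) = G (cat_mor x)) -> F =1 G.
Proof.
by rewrite cat_mor.unlock => eqF; apply: (eq_linear_malg (F := F) (G := G)).
Qed.

Lemma cat_mul_linl b : linear (cat_mul^~ b).
Proof. by move=> c a a'; rewrite cat_mul.unlock linearP. Qed.

Lemma cat_mul_linr a : linear (cat_mul a).
Proof.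
move=> c b b'; rewrite cat_mul.unlock -lin_ext_fun_linear.
by apply: eq_lin_ext => x; rewrite linearP.
Qed.

Lemma cat_mul_mor x y : cat_mul (cat_mor x) (cat_mor y) = cat_omor (comp x y).
Proof. by rewrite cat_mul.unlock !lin_ext_mor. Qed.

Definition cat_mull a b := cat_mul a b.
Definition cat_mulr b a := cat_mul a b.
HB.instance Definition _ a :=
  GRing.isLinear.Build k A A _ (cat_mull a) (cat_mul_linr a).
HB.instance Definition _ b :=
  GRing.isLinear.Build k A A _ (cat_mulr b) (cat_mul_linl b).

Lemma cat_mulDl : left_distributive cat_mul +%R.
Proof. by move=> a b c; exact: (linearD (cat_mulr c)). Qed.

Lemma cat_mulDr : right_distributive cat_mul +%R.
Proof. by move=> a b c; exact: (linearD (cat_mull a)). Qed.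

Lemma cat_mulA : associative cat_mul.
Proof.
move=> a b c.
apply: (eq_linear_cat (F := cat_mulr (cat_mul b c))
                       (G := cat_mulr c \o cat_mulr b)) => x /=.
apply: (eq_linear_cat (F := cat_mull (cat_mor x) \o cat_mulr c)
                       (G := cat_mulr c \o cat_mull (cat_mor x))) => y /=.
apply: (eq_linear_cat (F := cat_mull (cat_mor x) \o cat_mull (cat_mor y))
                       (G := cat_mull (cat_mul (cat_mor x) (cat_mor y)))) => z /=.
rewrite /cat_mull !cat_mul_mor.
have omull (o : option (mor C)) :
    cat_mul (cat_mor x) (cat_omor o) = cat_omor (obind (comp x) o).
  case: o => [t|] /=; first by rewrite cat_mul_mor.
  exact: (linear0 (cat_mull _)).
have omulr (o : option (mor C)) :
    cat_mul (cat_omor o) (cat_mor z) = cat_omor (obind ((@comp C)^~ z) o).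
  case: o => [t|] /=; first by rewrite cat_mul_mor.
  exact: (linear0 (cat_mulr _)).
by rewrite omull omulr compA.
Qed.

Lemma cat_mul1l : left_id cat_one cat_mul.
Proof.
move=> a; apply: (eq_linear_cat (F := cat_mull cat_one) (G := idfun)) => x /=.
rewrite /cat_mull cat_one.unlock -/(cat_mulr _ _) linear_sum (bigD1 (cod x)) //= big1.
  by rewrite addr0 /cat_mulr cat_mul_mor comp_idl eqxx.
by move=> v vNx; rewrite /cat_mulr cat_mul_mor comp_idl (negPf vNx).
Qed.

Lemma cat_mul1r : right_id cat_one cat_mul.
Proof.
move=> a; apply: (eq_linear_cat (F := cat_mulr cat_one) (G := idfun)) => x /=.
rewrite /cat_mulr cat_one.unlock -/(cat_mull _ _) linear_sum (bigD1 (dom x)) //= big1.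
  by rewrite addr0 /cat_mull cat_mul_mor comp_idr eqxx.
by move=> v vNx; rewrite /cat_mull cat_mul_mor comp_idr (negPf vNx).
Qed.

HB.instance Definition _ := GRing.Zmodule_isPzRing.Build A
  cat_mulA cat_mul1l cat_mul1r cat_mulDl cat_mulDr.

Lemma cat_oner_neq0 : (1 : A) != 0.
Proof.
have /card_gt0P[v _] := ob_inh C.
apply/eqP => eq10; have : cat_mor (idm v) = 0 by rewrite -[LHS]mul1r eq10 mul0r.
by rewrite cat_mor.unlock => /eqP; rewrite monalgU_eq0 oner_eq0.
Qed.
HB.instance Definition _ := GRing.PzSemiRing_isNonZero.Build A cat_oner_neq0.

Lemma cat_scalerAl (c : k) (a b : A) : c *: (a * b) = (c *: a) * b.
Proof. exact: (esym (linearZ_LR (cat_mulr b) c a)). Qed.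
HB.instance Definition _ := GRing.Lmodule_isLalgebra.Build k A cat_scalerAl.

Lemma cat_scalerAr (c : k) (a b : A) : c *: (a * b) = a * (c *: b).
Proof. exact: (esym (linearZ_LR (cat_mull a) c b)). Qed.
HB.instance Definition _ := GRing.Lalgebra_isAlgebra.Build k A cat_scalerAr.

End CategoryRing.

Section IdealQuotient.
Variables (k : fieldType) (R : algType k) (G : R -> Prop).

(* The two-sided ideal generated by G. *)
Inductive gen_ideal : R -> Prop :=
| gen_ideal_base x : G x -> gen_ideal x
| gen_ideal0 : gen_ideal 0
| gen_idealB x y : gen_ideal x -> gen_ideal y -> gen_ideal (x - y)
| gen_idealMl a x : gen_ideal x -> gen_ideal (a * x)
| gen_idealMr a x : gen_ideal x -> gen_ideal (x * a).

Definition ideal_pred : {pred R} := fun x => `[< gen_ideal x >].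

Lemma ideal_predP x : reflect (gen_ideal x) (x \in ideal_pred).
Proof. exact: asboolP. Qed.

Lemma ideal_pred_zmod_closed : zmod_closed ideal_pred.
Proof.
split=> [|x y /ideal_predP Ix /ideal_predP Iy]; apply/ideal_predP.
  exact: gen_ideal0.
exact: gen_idealB.
Qed.
HB.instance Definition _ :=
  GRing.isZmodClosed.Build R ideal_pred ideal_pred_zmod_closed.

Definition ideal_quot : Type := Quotient.quot ideal_pred.
HB.instance Definition _ := GRing.Zmodule.on ideal_quot.

Definition ideal_pi (x : R) : ideal_quot := \pi_(Quotient.quot ideal_pred)%qT x.
Definition ideal_repr (x : ideal_quot) : R :=
  generic_quotient.repr (x : Quotient.quot ideal_pred).

Lemma ideal_reprK : cancel ideal_repr ideal_pi.
Proof. exact: reprK. Qed.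

Lemma ideal_piP x y : ideal_pi x = ideal_pi y <-> gen_ideal (x - y).
Proof.
split=> [/eqP|]; first by rewrite -Quotient.idealrBE => /ideal_predP.
by move/ideal_predP; rewrite Quotient.idealrBE => /eqP.
Qed.

Lemma gen_ideal_repr x : gen_ideal (ideal_repr (ideal_pi x) - x).
Proof. by apply/ideal_piP; rewrite ideal_reprK. Qed.

Lemma ideal_pi0 : ideal_pi 0 = 0.
Proof. exact: (raddf0 (\pi_(Quotient.quot ideal_pred)%qT)). Qed.

Lemma ideal_piB : {morph ideal_pi : x y / x - y}.
Proof. exact: (raddfB (\pi_(Quotient.quot ideal_pred)%qT)). Qed.

Lemma ideal_piD : {morph ideal_pi : x y / x + y}.
Proof. exact: (raddfD (\pi_(Quotient.quot ideal_pred)%qT)). Qed.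

Definition quot_one : ideal_quot := ideal_pi 1.
Definition quot_mul (x y : ideal_quot) := ideal_pi (ideal_repr x * ideal_repr y).
Definition quot_scale (c : k) (x : ideal_quot) := ideal_pi (c *: ideal_repr x).

Lemma ideal_piM x y : ideal_pi (x * y) = quot_mul (ideal_pi x) (ideal_pi y).
Proof.
apply/esym/ideal_piP; set x' := ideal_repr _; set y' := ideal_repr _.
have -> : x' * y' - x * y = x' * (y' - y) - (x - x') * y.
  by rewrite mulrBr mulrBl opprB addrA subrK.
apply: gen_idealB; first exact/gen_idealMl/gen_ideal_repr.
by apply/gen_idealMr/ideal_piP; rewrite ideal_reprK.
Qed.

Lemma ideal_piZ c x : ideal_pi (c *: x) = quot_scale c (ideal_pi x).
Proof.
apply/esym/ideal_piP; rewrite -scalerBr -mulr_algl.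
exact/gen_idealMl/gen_ideal_repr.
Qed.

Let piE := (ideal_piM, ideal_piD, ideal_piZ).
Let piK (P : ideal_quot -> Prop) : (forall x, P (ideal_pi x)) -> forall x, P x.
Proof. by move=> Ppi x; rewrite -[x]ideal_reprK. Qed.

Lemma quot_mulA : associative quot_mul.
Proof. by do 3!elim/piK=> ?; rewrite -!piE mulrA. Qed.
Lemma quot_mul1r : left_id quot_one quot_mul.
Proof. by elim/piK=> ?; rewrite -!piE mul1r. Qed.
Lemma quot_mulr1 : right_id quot_one quot_mul.
Proof. by elim/piK=> ?; rewrite -!piE mulr1. Qed.
Lemma quot_mulDl : left_distributive quot_mul +%R.
Proof. by do 3!elim/piK=> ?; rewrite -!piE mulrDl !piE. Qed.
Lemma quot_mulDr : right_distributive quot_mul +%R.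
Proof. by do 3!elim/piK=> ?; rewrite -!piE mulrDr !piE. Qed.
HB.instance Definition _ := GRing.Zmodule_isPzRing.Build ideal_quot
  quot_mulA quot_mul1r quot_mulr1 quot_mulDl quot_mulDr.

Lemma quot_scaleA a b x : quot_scale a (quot_scale b x) = quot_scale (a * b) x.
Proof. by elim/piK: x => ?; rewrite -!piE scalerA. Qed.
Lemma quot_scale1 : left_id 1 quot_scale.
Proof. by elim/piK=> ?; rewrite -!piE scale1r. Qed.
Lemma quot_scaleDr : right_distributive quot_scale +%R.
Proof. by move=> a; do 2!elim/piK=> ?; rewrite -!piE scalerDr !piE. Qed.
Lemma quot_scaleDl x : {morph quot_scale^~ x : a b / a + b}.
Proof. by elim/piK: x => x a b; rewrite -!piE scalerDl. Qed.
HB.instance Definition _ := GRing.Zmodule_isLmodule.Build k ideal_quot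
  quot_scaleA quot_scale1 quot_scaleDr quot_scaleDl.

Lemma quot_scaleAl (c : k) (x y : ideal_quot) : c *: (x * y) = (c *: x) * y.
Proof.
elim/piK: x => x; elim/piK: y => y.
by change (quot_scale c (quot_mul (ideal_pi x) (ideal_pi y)) =
  quot_mul (quot_scale c (ideal_pi x)) (ideal_pi y)); rewrite -!piE scalerAl.
Qed.
Lemma quot_scaleAr (c : k) (x y : ideal_quot) : c *: (x * y) = x * (c *: y).
Proof.
elim/piK: x => x; elim/piK: y => y.
by change (quot_scale c (quot_mul (ideal_pi x) (ideal_pi y)) =
  quot_mul (ideal_pi x) (quot_scale c (ideal_pi y))); rewrite -!piE scalerAr.
Qed.

End IdealQuotient.

Section Converse.
Variables (k : fieldType) (A : algType k).
HB.instance Definition _ := GRing.Lmodule.on A^c.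
Fact converse_scalerAl (c : k) (x y : A^c) :
  c *: (x * y) = (c *: x : A^c) * y.
Proof. exact: (@scalerAr k A c y x). Qed.
HB.instance Definition _ :=
  GRing.Lmodule_isLalgebra.Build k A^c converse_scalerAl.
Fact converse_scalerAr (c : k) (x y : A^c) :
  c *: (x * y) = x * (c *: y : A^c).
Proof. exact: (@scalerAl k A c y x). Qed.
HB.instance Definition _ :=
  GRing.Lalgebra_isAlgebra.Build k A^c converse_scalerAr.
End Converse.

Section Tensor.
Variables (k : fieldType) (A B : algType k).

Lemma pair_comp_idl (v : unit) (x : A * B) :
  Some (1 * x.1, 1 * x.2) = if v == tt then Some x else None.
Proof. by case: v x => -[a b]; rewrite !mul1r. Qed.
Lemma pair_comp_idr (v : unit) (x : A * B) :
  Some (x.1 * 1, x.2 * 1) = if v == tt then Some x else None.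
Proof. by case: v x => -[a b]; rewrite !mulr1. Qed.

(* The multiplicative monoid A x B, as a category with one object. *)
Definition pair_cat : fin_cat.
Proof.
refine (@FinCat unit (A * B)%type (fun=> tt) (fun=> tt) (fun=> (1, 1))
  (fun x y => Some (x.1 * y.1, x.2 * y.2)) _ _ pair_comp_idl pair_comp_idr _).
- by rewrite card_unit.
- by [].
- by move=> x y z /=; rewrite !mulrA.
Defined.

Local Notation kAB := (cat_alg k pair_cat).
Definition pure (a : A) (b : B) : kAB := cat_mor k (C := pair_cat) (a, b).

Variant tensor_rel : kAB -> Prop :=
| tensor_addl a a' b : tensor_rel (pure (a + a') b - (pure a b + pure a' b))
| tensor_addr a b b' : tensor_rel (pure a (b + b') - (pure a b + pure a b'))
| tensor_scalel c a b : tensor_rel (pure (c *: a) b - c *: pure a b)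
| tensor_scaler c a b : tensor_rel (pure a (c *: b) - c *: pure a b).

Definition tensor : Type := ideal_quot tensor_rel.
HB.instance Definition _ := GRing.PzRing.on tensor.
HB.instance Definition _ := GRing.Lmodule.on tensor.

Definition tens (a : A) (b : B) : tensor := ideal_pi tensor_rel (pure a b).

End Tensor.

Section EnvelopingAlgebra.
Variables (k : fieldType) (A : algType k).

Definition env_alg : Type := tensor A A^c.
HB.instance Definition _ := GRing.PzRing.on env_alg.
HB.instance Definition _ := GRing.Lmodule.on env_alg.

Definition sandwich (a b x : A) : A := a * x * b.
Lemma sandwich_is_linear a b : linear (sandwich a b).
Proof.
by move=> c x y; rewrite /sandwich mulrDr mulrDl -scalerAr -scalerAl.
Qed.
HB.instance Definition _ a b :=
  GRing.isLinear.Build k A A _ (sandwich a b) (sandwich_is_linear a b).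

Local Notation kAA := (cat_alg k (pair_cat A A^c)).

Definition pair_act (u : kAA) (x : A) : A :=
  lin_ext (fun p : mor (pair_cat A A^c) => sandwich p.1 p.2 x) u.

Lemma pair_act_is_linear x : linear (pair_act^~ x).
Proof. by move=> c u v; rewrite /pair_act linearP. Qed.

Lemma pair_actDr u x y : pair_act u (x + y) = pair_act u x + pair_act u y.
Proof.
rewrite /pair_act -[X in _ = X + _]scale1r -lin_ext_fun_linear.
by apply: eq_lin_ext => p; rewrite linearD scale1r.
Qed.

Lemma pair_act_pure a b x : pair_act (pure a b) x = a * x * b.
Proof. exact: (lin_ext_mor (C := pair_cat A A^c)). Qed.

Lemma pair_act1 x : pair_act 1 x = x.
Proof.
transitivity (pair_act (pure 1 1) x); last by rewrite pair_act_pure mul1r mulr1.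
congr (pair_act _ x); transitivity (\sum_(v : unit) pure (1 : A) (1 : A^c)).
  by rewrite -[LHS]/(cat_one _ _) cat_one.unlock.
by rewrite big_const card_unit /= addr0.
Qed.

Lemma pair_actM u v x : pair_act (u * v) x = pair_act u (pair_act v x).
Proof.
pose f y (p : mor (pair_cat A A^c)) := sandwich p.1 p.2 y.
have fE y p : lin_ext (f y) (cat_mor k p) = sandwich p.1 p.2 y.
  exact: lin_ext_mor.
apply: (eq_linear_cat (F := lin_ext (f x) \o cat_mulr v)
                      (G := lin_ext (f (pair_act v x)))) => p.
rewrite [RHS]fE.
apply: (eq_linear_cat (F := lin_ext (f x) \o cat_mull (cat_mor _ p))
                      (G := sandwich p.1 p.2 \o lin_ext (f x))) => q.
transitivity (lin_ext (f x) (cat_omor k (comp p q))).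
  by congr (lin_ext _ _); exact: cat_mul_mor.
rewrite [LHS]fE [in RHS]/= fE /sandwich /=.
by rewrite !mulrA; congr (_ * _); rewrite -!mulrA.
Qed.

Lemma pair_act_ideal u x : gen_ideal (@tensor_rel k A A^c) u -> pair_act u x = 0.
Proof.
have actB u1 v1 y : pair_act (u1 - v1) y = pair_act u1 y - pair_act v1 y.
  by rewrite -scaleN1r addrC pair_act_is_linear scaleN1r addrC.
have actD u1 v1 y : pair_act (u1 + v1) y = pair_act u1 y + pair_act v1 y.
  by rewrite -[u1]scale1r pair_act_is_linear !scale1r.
have act0 y : pair_act 0 y = 0 by rewrite -(subrr 0) actB subrr.
have actZ c u1 y : pair_act (c *: u1) y = c *: pair_act u1 y.
  by rewrite -[c *: u1]addr0 pair_act_is_linear act0 addr0.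
have actr0 u1 : pair_act u1 0 = 0.
  by apply: (addrI (pair_act u1 0)); rewrite -pair_actDr !addr0.
move=> Iu; elim: Iu x => {u} [u|x|u v _ IHu _ IHv x|u v _ IHv x|u v _ IHv x].
- case=> [a a' b|a b b'|c a b|c a b] x; rewrite actB ?actD ?actZ !pair_act_pure.
  + by rewrite !mulrDl subrr.
  + by rewrite !mulrDr subrr.
  + by rewrite -!scalerAl subrr.
  + by rewrite -scalerAr subrr.
- exact: act0.
- by rewrite actB IHu IHv subrr.
- by rewrite pair_actM IHv actr0.
- by rewrite pair_actM IHv.
Qed.

(* A as a left A^e-module: (a (x) b) x = a x b. *)
Definition reg_bimod : Type := A.
HB.instance Definition _ := GRing.Zmodule.on reg_bimod.

Definition env_act (e : env_alg) (x : reg_bimod) : reg_bimod :=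
  pair_act (ideal_repr e) x.

Lemma env_act_pi u x : env_act (ideal_pi _ u) x = pair_act u x.
Proof.
have := @pair_act_ideal _ x (gen_ideal_repr (@tensor_rel k A A^c) u).
rewrite -scaleN1r addrC pair_act_is_linear scaleN1r addrC => /eqP.
by rewrite subr_eq0 => /eqP.
Qed.

Lemma env_act_tens a b x : env_act (tens a b) x = (a : A) * x * b.
Proof. by rewrite env_act_pi pair_act_pure. Qed.

Lemma env_actA e f x : env_act e (env_act f x) = env_act (e * f) x.
Proof. by rewrite [RHS]env_act_pi pair_actM. Qed.
Lemma env_act1 : left_id 1 env_act.
Proof. by move=> x; rewrite [LHS]env_act_pi pair_act1. Qed.
Lemma env_actDr : right_distributive env_act +%R.
Proof. by move=> e x y; exact: pair_actDr. Qed.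
Lemma env_actDl x : {morph env_act^~ x : e f / e + f}.
Proof.
move=> e f; rewrite -[e]ideal_reprK -[f]ideal_reprK -ideal_piD !env_act_pi.
by rewrite -[ideal_repr e]scale1r pair_act_is_linear !scale1r.
Qed.
HB.instance Definition _ := GRing.Zmodule_isLmodule.Build env_alg reg_bimod
  env_actA env_act1 env_actDr env_actDl.

Definition central (z : A) : Prop := forall a, z * a = a * z.

End EnvelopingAlgebra.

Definition projective (R : pzRingType) (P : lmodType R) : Prop :=
  forall (M N : lmodType R) (g : {linear M -> N}) (f : {linear P -> N}),
    (forall y, exists x, g x = y) ->
  exists h : {linear P -> M}, forall p, g (h p) = f p.

(* Z^pr(A), under the identification of Z(A) with End_{A^e}(A) that sends z to
   the multiplication by z. *)
Definition projective_center (k : fieldType) (A : algType k) (z : A) : Prop :=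
  central z /\
  exists (P : lmodType (env_alg A)) (f : {linear reg_bimod A -> P})
         (g : {linear P -> reg_bimod A}),
    projective P /\ forall a : A, g (f a) = z * a.

Record quiver := Quiver {
  Q0 : finType;
  Q1 : finType;
  src : Q1 -> Q0;
  tgt : Q1 -> Q0;
  Q0_inh : (0 < #|Q0|)%N
}.

Section PathAlgebra.
Variable Q : quiver.
Implicit Types (v w : Q0 Q) (s : seq (Q1 Q)).

(* Paths are written from right to left: (v, [:: a1; ...; an]) is the path
   a1 ... an with terminus v, so that src a_i = tgt a_(i+1). *)
Fixpoint is_path v s : bool :=
  if s is a :: s' then (tgt a == v) && is_path (src a) s' else true.

Definition path_src v s : Q0 Q := last v [seq src a | a <- s].

Lemma is_path_cat v s1 s2 :
  is_path v (s1 ++ s2) = is_path v s1 && is_path (path_src v s1) s2.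
Proof. by elim: s1 v => //= a s1 IHs v; rewrite IHs andbA. Qed.

Lemma path_src_cat v s1 s2 :
  path_src v (s1 ++ s2) = path_src (path_src v s1) s2.
Proof. by rewrite /path_src map_cat last_cat. Qed.

Record qpath := QPath { qpath_val : Q0 Q * seq (Q1 Q);
                        _ : is_path qpath_val.1 qpath_val.2 }.
HB.instance Definition _ := [isSub for qpath_val].
HB.instance Definition _ := [Choice of qpath by <:].

Definition qtgt (p : qpath) : Q0 Q := (val p).1.
Definition qarrows (p : qpath) : seq (Q1 Q) := (val p).2.
Definition qsrc (p : qpath) : Q0 Q := path_src (qtgt p) (qarrows p).

Definition qid v : qpath := @QPath (v, [::]) isT.
Definition qcomp (p q : qpath) : option qpath :=
  if qsrc p == qtgt q then insub (qtgt p, qarrows p ++ qarrows q) else None.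

Lemma qpathP (p : qpath) : is_path (qtgt p) (qarrows p).
Proof. exact: valP p. Qed.

Lemma qcompP (p q : qpath) : qsrc p = qtgt q ->
  {r | qcomp p q = Some r & val r = (qtgt p, qarrows p ++ qarrows q)}.
Proof.
move=> pq.
have pqP : is_path (qtgt p) (qarrows p ++ qarrows q).
  by rewrite is_path_cat qpathP /= -/(qsrc p) pq qpathP.
by exists (@QPath (qtgt p, qarrows p ++ qarrows q) pqP);
  rewrite // /qcomp pq eqxx insubT.
Qed.

Lemma qcomp_def p q : isSome (qcomp p q) = (qsrc p == qtgt q).
Proof.
by have [/qcompP[r -> _]//|ne] := eqVneq; rewrite /qcomp (negPf ne).
Qed.

Lemma qcomp_idl v p : qcomp (qid v) p = if v == qtgt p then Some p else None.
Proof.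
have [->|ne] := eqVneq v (qtgt p); last by rewrite /qcomp /qsrc /= (negPf ne).
have [r -> er] := @qcompP (qid (qtgt p)) p erefl.
by congr Some; apply: val_inj; rewrite er; case: (p) => -[].
Qed.

Lemma qcomp_idr v p : qcomp p (qid v) = if v == qsrc p then Some p else None.
Proof.
have [->|ne] := eqVneq v (qsrc p); last by rewrite /qcomp eq_sym (negPf ne).
have [r -> er] := @qcompP p (qid (qsrc p)) erefl.
by congr Some; apply: val_inj; rewrite er cats0; case: (p) => -[].
Qed.

Lemma qcompA p q r :
  obind (qcomp p) (qcomp q r) = obind (qcomp^~ r) (qcomp p q).
Proof.
have [qr|nqr] := eqVneq (qsrc q) (qtgt r); last first.
  rewrite {2}/qcomp (negPf nqr) /=.
  have [pq|npq] := eqVneq (qsrc p) (qtgt q); last by rewrite /qcomp (negPf npq).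
  have [s -> es] := qcompP pq => /=.
  rewrite /qcomp {1}/qsrc {1}/qtgt {1}/qarrows es /= path_src_cat -/(qsrc p) pq.
  by rewrite (negPf nqr).
have [t -> et] := qcompP qr => /=.
have tq : qtgt t = qtgt q by rewrite /qtgt et.
have [pq|npq] := eqVneq (qsrc p) (qtgt q); last first.
  by rewrite /qcomp tq (negPf npq).
have [s -> es] := qcompP pq => /=.
have pt : qsrc p = qtgt t by rewrite tq.
have sr : qsrc s = qtgt r.
  by rewrite /qsrc /qtgt /qarrows es /= path_src_cat -/(qsrc p) pq.
have [x -> ex] := qcompP pt; have [y -> ey] := qcompP sr.
congr Some; apply: val_inj; rewrite ex ey /qtgt /qarrows es et /=.
by rewrite catA.
Qed.

Definition path_cat : fin_cat :=
  FinCat (Q0_inh Q) qcomp_def qcomp_idl qcomp_idr qcompA.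

Definition arrow_path (a : Q1 Q) : qpath :=
  @QPath (tgt a, [:: a]) (introT andP (conj (eqxx _) isT)).

End PathAlgebra.

Definition path_alg (k : fieldType) (Q : quiver) := cat_alg k (path_cat Q).
Definition arrow_elt (k : fieldType) (Q : quiver) (a : Q1 Q) : path_alg k Q :=
  cat_mor k (C := path_cat Q) (arrow_path a).

(* [base], [flip] and [rot] are the maps r, iota and rho of a ribbon graph;
   loops and multiple edges are allowed. *)
Record ribbon_graph := RibbonGraph {
  vertex : finType;
  half_edge : finType;
  base : half_edge -> vertex;
  flip : half_edge -> half_edge;
  rot : {perm half_edge};
  flipK : involutive flip;
  flip_neq : forall h, flip h != h;
  porbits_rot :
    porbits rot = [set [set h | base h == v] | v in [set: vertex]];
  vertex_inh : (0 < #|vertex|)%N;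
  graph_connected : forall v w,
    connect [rel x y | [exists h, (base h == x) && (base (flip h) == y)]] v w
}.

Record brauer_graph := BrauerGraph {
  brauer_ribbon :> ribbon_graph;
  mult : vertex brauer_ribbon -> nat;
  mult_gt0 : forall v, (0 < mult v)%N
}.

Section BrauerQuiver.
Variable G : brauer_graph.
Local Notation H := (half_edge G).
Implicit Types (h : H) (v : vertex G).

Definition half_edges_at v : {set H} := [set h | base h == v].
Definition valency v : nat := #|half_edges_at v|.
Definition truncated v : bool := (mult v * valency v == 1)%N.

Definition edge_set h : {set H} := [set h; flip h].
Record edge := Edge { edge_val : {set H};
                      _ : edge_val \in [set edge_set h | h in [set: H]] }.
HB.instance Definition _ := [isSub for edge_val].
HB.instance Definition _ := [Finite of edge by <:].

Lemma edge_of_subproof h : edge_set h \in [set edge_set h | h in [set: H]].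
Proof. exact: imset_f. Qed.
Definition edge_of h : edge := Edge (edge_of_subproof h).

Definition single_truncated_edge : bool :=
  (#|{: edge}| == 1)%N && [forall v, truncated v].

(* There is an arrow for each h with base h not truncated. When G is a single
   edge with two truncated vertices there are no such h, and one of the two
   half-edges is kept: its rotation is itself, so that the quiver is one loop
   alpha with sigma alpha = alpha, C_alpha = alpha and m(C_alpha) = 1, the
   relations below reduce to alpha^2, and the quotient is k[alpha]/(alpha^2). *)
Definition is_arrow h : bool :=
  ~~ truncated (base h) || (single_truncated_edge && ([pick h' : H] == Some h)).

Record arrow := Arrow { arrow_val : H; _ : is_arrow arrow_val }.
HB.instance Definition _ := [isSub for arrow_val].
HB.instance Definition _ := [Finite of arrow by <:].

Lemma mem_half_edges_rot h h' : base h = base h' <-> h' \in porbit (rot G) h.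
Proof.
have: porbit (rot G) h \in porbits (rot G) by exact: imset_f.
rewrite porbits_rot => /imsetP[v _ eqv].
have := porbit_id (rot G) h; rewrite eqv !inE => /eqP ->.
by split=> [->|/eqP].
Qed.

Lemma base_rotV h : base ((rot G)^-1%g h) = base h.
Proof.
apply/mem_half_edges_rot; rewrite porbit_sym.
by have := mem_porbit (rot G)^-1%g 1 h; rewrite porbitV expg1 porbit_sym.
Qed.

Lemma valency_gt0 v : (0 < valency v)%N.
Proof.
have: half_edges_at v \in porbits (rot G) by rewrite porbits_rot; exact: imset_f.
by case/imsetP=> h _; rewrite /valency => ->; apply/card_gt0P; exists h;
  exact: porbit_id.
Qed.

Lemma truncated_half_edge h h' :
  truncated (base h) -> base h' = base h -> h' = h.
Proof.
rewrite /truncated muln_eq1 => /andP[_ /cards1P[x eqx]] bh.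
have : h \in half_edges_at (base h) by rewrite inE.
have : h' \in half_edges_at (base h) by rewrite inE bh.
by rewrite eqx !inE => /eqP -> /eqP ->.
Qed.

Lemma sigma_subproof (a : arrow) : is_arrow ((rot G)^-1%g (val a)).
Proof.
case: a => h /= arr_h; case tr: (truncated (base h)).
  by rewrite (truncated_half_edge tr (base_rotV h)).
by rewrite /is_arrow base_rotV tr.
Qed.
Definition sigma (a : arrow) : arrow := Arrow (sigma_subproof a).

Lemma edge_inh : (0 < #|{: edge}|)%N.
Proof.
have /card_gt0P[v _] := vertex_inh G; have /card_gt0P[h _] := valency_gt0 v.
by apply/card_gt0P; exists (edge_of h).
Qed.

Definition brauer_quiver : quiver :=
  @Quiver edge arrow (fun a => edge_of (val a))
          (fun a => edge_of (rot G (val a))) edge_inh.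

End BrauerQuiver.

Section BrauerAlgebra.
Variables (k : fieldType) (G : brauer_graph).
Local Notation kQ := (path_alg k (brauer_quiver G)).
Implicit Types (a b : arrow G).

Local Notation arr := (@arrow_elt k (brauer_quiver G)).
Local Notation tgt := (@tgt (brauer_quiver G)).
Local Notation src := (@src (brauer_quiver G)).

(* C_a = a sigma(a) ... sigma^l(a), with l + 1 the size of the sigma-orbit. *)
Definition arrow_cycle a : kQ :=
  \prod_(i < fingraph.order (@sigma G) a) arr (iter i (@sigma G) a).

Definition cycle_mult a : nat := mult (base (val a)).

Variant brauer_rel : kQ -> Prop :=
| brauer_rel_a a b of tgt a = tgt b :
    brauer_rel (arrow_cycle a ^+ cycle_mult a - arrow_cycle b ^+ cycle_mult b)
| brauer_rel_b a : brauer_rel (arr a * arrow_cycle (sigma a) ^+ cycle_mult a)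
| brauer_rel_c a b of src a = tgt b & b != sigma a :
    brauer_rel (arr a * arr b).

Definition brauer_alg : Type := ideal_quot brauer_rel.
HB.instance Definition _ := GRing.PzRing.on brauer_alg.
HB.instance Definition _ := GRing.Lmodule.on brauer_alg.

End BrauerAlgebra.

Section BrauerNonzero.
Variables (k : fieldType) (G : brauer_graph).
Local Notation Q := (brauer_quiver G).
Local Notation kQ := (path_alg k Q).

Definition triv_coeff (e : Q0 Q) (x : kQ) : k^o := mcoeff (qid e) x.

Lemma triv_coeff_is_linear e : linear (triv_coeff e).
Proof. by move=> c x y; rewrite /triv_coeff mcoeffD mcoeffZ. Qed.
HB.instance Definition _ e :=
  GRing.isLinear.Build k kQ k^o _ (triv_coeff e) (triv_coeff_is_linear e).

Lemma triv_coeff_mor e (p : qpath Q) :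
  triv_coeff e (cat_mor k (C := path_cat Q) p) = (p == qid e)%:R.
Proof. by rewrite /triv_coeff cat_mor.unlock mcoeffU. Qed.

Lemma triv_coeff_comp e (p q : qpath Q) :
  triv_coeff e (cat_omor k (C := path_cat Q) (qcomp p q)) =
    (p == qid e)%:R * (q == qid e)%:R.
Proof.
rewrite -natrM mulnb.
case: (eqVneq (qsrc p) (qtgt q)) => [pq|npq].
  have [r -> er] := qcompP pq.
  rewrite [LHS]triv_coeff_mor; congr (nat_of_bool _)%:R.
  rewrite -[r == _]val_eqE -[p == _]val_eqE -[q == _]val_eqE er.
  case: p q pq {er} => [[v s] ps] [[w t] pt].
  rewrite !xpair_eqE /qtgt /qarrows /qsrc /qtgt /qarrows /=.
  case: s {ps} => [|a s]; last by rewrite !andbF.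
  case: t {pt} => [|b t]; last by rewrite !andbF.
  by rewrite /path_src /= => <-; rewrite !andbT andbb.
rewrite /qcomp (negPf npq) [LHS]linear0.
case: eqP => [ep|//]; case: eqP => [eq|//]; case/eqP: npq.
by rewrite ep eq.
Qed.

Lemma triv_coeffM e (x y : kQ) :
  triv_coeff e (x * y) = triv_coeff e x * triv_coeff e y.
Proof.
have mulKl (c : k) : linear (fun z : k^o => c * z : k^o).
  by move=> d z t; rewrite mulrDr /GRing.scale /= mulrCA.
have mulKr (c : k) : linear (fun z : k^o => z * c : k^o).
  by move=> d z t; rewrite mulrDl /GRing.scale /= mulrA.
pose ml c : {linear k^o -> k^o} :=
  HB.pack (fun z : k^o => c * z : k^o)
          (GRing.isLinear.Build _ _ _ _ _ (mulKl c)).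
pose mr c : {linear k^o -> k^o} :=
  HB.pack (fun z : k^o => z * c : k^o)
          (GRing.isLinear.Build _ _ _ _ _ (mulKr c)).
move: x; apply: (eq_linear_cat
  (F := triv_coeff e \o cat_mulr y) (G := mr (triv_coeff e y) \o triv_coeff e)).
move=> p; move: y; apply: (eq_linear_cat
  (F := triv_coeff e \o cat_mull (cat_mor k (C := path_cat Q) p))
  (G := ml (triv_coeff e (cat_mor k (C := path_cat Q) p)) \o triv_coeff e)) => q.
transitivity (triv_coeff e (cat_omor k (C := path_cat Q) (qcomp p q))).
  by congr (triv_coeff e _); exact: cat_mul_mor.
exact: (etrans (triv_coeff_comp e p q)
  (esym (congr2 *%R (triv_coeff_mor e p) (triv_coeff_mor e q)))).
Qed.

Lemma triv_coeff_cycle e (a : arrow G) : triv_coeff e (arrow_cycle k a) = 0.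
Proof.
rewrite /arrow_cycle -fingraph.orderSpred big_ord_recl triv_coeffM.
rewrite triv_coeff_mor; case: eqP => [/(congr1 val)//|_]; exact: mul0r.
Qed.

Lemma triv_coeff_cycleX e (a : arrow G) n : (0 < n)%N ->
  triv_coeff e (arrow_cycle k a ^+ n) = 0.
Proof.
by case: n => // n _; rewrite exprS triv_coeffM triv_coeff_cycle mul0r.
Qed.

Lemma triv_coeffB e : {morph triv_coeff e : x y / x - y}.
Proof. exact: (linearB (triv_coeff e)). Qed.

Lemma triv_coeff_ideal e x : gen_ideal (@brauer_rel k G) x -> triv_coeff e x = 0.
Proof.
have arr0 (a : arrow G) : triv_coeff e (arrow_elt k (Q := Q) a) = 0.
  by rewrite triv_coeff_mor; case: eqP => [/(congr1 val)//|].
elim=> {x} [x|||c x _ IHx|c x _ IHx].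
- case=> [a b _|a|a b _ _].
  + rewrite triv_coeffB (triv_coeff_cycleX e a (mult_gt0 _)).
    by rewrite (triv_coeff_cycleX e b (mult_gt0 _)) subrr.
  + by rewrite triv_coeffM (arr0 a) mul0r.
  + by rewrite triv_coeffM (arr0 a) mul0r.
- exact: (linear0 (triv_coeff e)).
- by move=> x y _ IHx _ IHy; rewrite triv_coeffB IHx IHy subrr.
- by rewrite triv_coeffM IHx mulr0.
- by rewrite triv_coeffM IHx mul0r.
Qed.

Local Notation A := (brauer_alg k G).

Lemma brauer_oner_neq0 : (1 : A) != 0.
Proof.
apply/eqP => A10.
have: ideal_pi (@brauer_rel k G) 1 = ideal_pi (@brauer_rel k G) 0.
  by rewrite ideal_pi0; exact: A10.
move/ideal_piP; rewrite subr0 => I1; have /card_gt0P[e _] := edge_inh G.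
have := triv_coeff_mor e (qid (Q := Q) e); rewrite eqxx -[cat_mor _ _]mul1r triv_coeffM.
rewrite (triv_coeff_ideal e I1) mul0r => /eqP.
by rewrite eq_sym oner_eq0.
Qed.
HB.instance Definition _ :=
  GRing.PzSemiRing_isNonZero.Build A brauer_oner_neq0.

Fact brauer_scalerAl (c : k) (x y : A) : c *: (x * y) = (c *: x) * y.
Proof. exact: quot_scaleAl. Qed.
HB.instance Definition _ := GRing.Lmodule_isLalgebra.Build k A brauer_scalerAl.

Fact brauer_scalerAr (c : k) (x y : A) : c *: (x * y) = x * (c *: y).
Proof. exact: quot_scaleAr. Qed.
HB.instance Definition _ := GRing.Lalgebra_isAlgebra.Build k A brauer_scalerAr.

End BrauerNonzero.

Section BrauerElements.
Variables (k : fieldType) (G : brauer_graph).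
Local Notation Q := (brauer_quiver G).
Local Notation A := (brauer_alg k G).
Implicit Types (a b : arrow G) (e : edge G) (v : vertex G).

Definition brauer_pi (x : path_alg k Q) : A := ideal_pi (@brauer_rel k G) x.
Definition cycle_elt a : A := brauer_pi (arrow_cycle k a).

(* The element s_e for an edge e of G, that is, a vertex of the quiver. *)
Definition socle_elt e : A :=
  if [pick a : arrow G | tgt (q := Q) a == e] is Some a
  then cycle_elt a ^+ cycle_mult a else 0.

Lemma brauer_piX x n : brauer_pi (x ^+ n) = brauer_pi x ^+ n.
Proof.
elim: n => [|n IHn]; first by [].
by rewrite exprS [RHS]exprS -IHn; exact: ideal_piM.
Qed.

Lemma socle_eltE a : socle_elt (tgt (q := Q) a) = cycle_elt a ^+ cycle_mult a.
Proof.
rewrite /socle_elt; case: pickP => [b /eqP ba|/(_ a)]; last by rewrite eqxx.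
rewrite -!brauer_piX; apply/ideal_piP; apply: gen_ideal_base.
exact: brauer_rel_a.
Qed.

(* The default value 0 in [socle_elt] is never used. *)
Lemma arrow_tgt_surj e : exists a : arrow G, tgt (q := Q) a = e.
Proof.
have tgt_arr h : is_arrow h -> exists a : arrow G, tgt (q := Q) a = edge_of h.
  move=> arr_h; exists (sigma (Arrow arr_h)).
  by congr edge_of; rewrite /= permKV.
case: e => E EP; have /imsetP[h _ eqE] := EP.
have -> : Edge EP = edge_of h by apply: val_inj.
have edge_flip (h1 : half_edge G) : edge_of (flip h1) = edge_of h1.
  by apply: val_inj; rewrite /= /edge_set flipK setUC.
case th: (truncated (base h)); last by apply: tgt_arr; rewrite /is_arrow th.
case tfh: (truncated (base (flip h))); last first.
  by rewrite -edge_flip; apply: tgt_arr; rewrite /is_arrow tfh.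
have Hh h' : h' \in edge_set h.
  pose D := [pred v | (v == base h) || (v == base (flip h))].
  pose r := [rel x y : vertex G |
    [exists h0, (base h0 == x) && (base (flip h0) == y)]].
  have clD x y : connect r x y -> D x -> D y.
    case/connectP=> s + ->; elim: s x => //= z s IHs x /andP[rxz /IHs IHz] Dx.
    apply: IHz; case/existsP: rxz => h1 /andP[/eqP bx /eqP <-].
    case/orP: Dx; rewrite -bx => /eqP bh.
      by rewrite (truncated_half_edge th bh) /= eqxx orbT.
    by rewrite (truncated_half_edge tfh bh) /= flipK eqxx.
  have /= := clD _ _ (graph_connected (base h) (base h')).
  rewrite eqxx => /(_ isT) /orP[] /eqP bh; rewrite !inE.
    by rewrite (truncated_half_edge th bh) eqxx.
  by rewrite (truncated_half_edge tfh bh) eqxx orbT.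
have sgl : single_truncated_edge G.
  apply/andP; split; last first.
    apply/forallP => v; have /card_gt0P[h'] := valency_gt0 v.
    by rewrite inE => /eqP <-; have := Hh h'; rewrite !inE => /orP[] /eqP ->.
  apply/eqP/esym/eqP; rewrite eqn_leq edge_inh /=.
  apply/card_le1_eqP => -[E1 EP1] [E2 EP2] _ _; apply: val_inj => /=.
  have eqEh E3 : E3 \in [set edge_set h | h in [set: half_edge G]] ->
      E3 = edge_set h.
    case/imsetP=> h1 _ ->; rewrite /edge_set.
    have := Hh h1; rewrite !inE => /orP[] /eqP -> //.
    by rewrite flipK setUC.
  by rewrite (eqEh _ EP1) (eqEh _ EP2).
case pk: [pick h' : half_edge G] => [h0|]; last first.
  by move: pk; case: pickP => // /(_ h).
have arr0 : is_arrow h0 by rewrite /is_arrow sgl pk eqxx orbT.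
have [a ea] := tgt_arr _ arr0; exists a; rewrite ea.
by have := Hh h0; rewrite !inE => /orP[] /eqP ->; rewrite ?edge_flip.
Qed.

(* The sum p_v of the rotations of the cycle around v. *)
Definition vertex_cycles v : A :=
  \sum_(a : arrow G | base (val a) == v) cycle_elt a.

(* The element p_v^(m v); a truncated vertex has a unique half-edge. *)
Definition vertex_elt v : A :=
  if truncated v then
    if [pick h | base h == v] is Some h then socle_elt (edge_of h) else 0
  else vertex_cycles v ^+ mult v.

End BrauerElements.

(* Main.v *)
Require Import Defs.
From HB Require Import structures.
From mathcomp Require Import all_boot all_order all_fingroup all_algebra.

(* A = A_Gamma is symmetric: the linear form t sending the paths C_a^m(C_a) to 1
   and all other paths to 0 kills the relations. For dual bases (b, b') of t,
   lifting along A^e -> A identifies Z^pr(A) with the image of the trace map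
   tau(c) = sum_b b c b'. Nontrivial paths are killed by tau, and
   tau(e_v) = sum_w dim(e_w A e_v) s_w = sum_x m_x n_x(v) p_x^(m_x), where n_x(v)
   is the number of half-edges of v at x and p_x^(m_x) = sum_w n_x(w) s_w. Thus
   Z^pr(A) corresponds to the image of the Cartan matrix N^T D N, with N the
   incidence matrix and D > 0 the diagonal matrix of multiplicities; in
   characteristic zero it has the same row space as N. *)

Set Implicit Arguments.
Unset Strict Implicit.
Unset Printing Implicit Defensive.

Import Order.TTheory Num.Theory.
Import GRing.Theory.
Local Open Scope ring_scope.

(** * Incidence matrices in characteristic zero *)

(** Integrality is phrased through [numq], so that the integer is given as a function of [i]. *)
Lemma common_denominator (T : finType) (f : T -> rat) :
  exists2 d : int, d != 0 & forall i, d%:~R * f i = (numq (d%:~R * f i))%:~R.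
Proof.
exists (\prod_i denq (f i)).
  by apply/prodf_neq0 => i _; rewrite denq_neq0.
move=> i; suff [y ->] : exists y : int, (\prod_i denq (f i))%:~R * f i = y%:~R.
  by rewrite numq_int.
exists ((\prod_(j | j != i) denq (f j)) * numq (f i)).
by rewrite (bigD1 i) //= mulrC rmorphM /= mulrA -numqE -intrM mulrC.
Qed.

Section RationalGram.
Variables (I J : finType) (n : I -> J -> nat) (m : I -> nat).
Hypothesis m_gt0 : forall i, (0 < m i)%N.

Definition weighted_gram (v j : J) : nat := \sum_x m x * n x v * n x j.

(** Write N for the matrix of [n] and M for N^T D N. If M K = 0, then (N K)^T D (N K) = K^T M K = 0,
    and positivity of D over the rationals forces N K = 0. Taking K to be the cokernel of M puts the
    rows of N in the row space of M. *)
Lemma incidence_sub_gram : exists X : I -> J -> rat, forall i j,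
  (n i j)%:R = \sum_v X i v * (weighted_gram v j)%:R.
Proof.
pose B : 'M[rat]_(#|I|, #|J|) :=
  \matrix_(i, j) (n (enum_val i) (enum_val j))%:R.
pose D : 'M[rat]_#|I| := diag_mx (\row_i (m (enum_val i))%:R).
pose M := B^T *m D *m B.
have /submxP[X eqB] : (B <= M)%MS.
  rewrite submxE; set K := cokermx M.
  have : (B *m K)^T *m D *m (B *m K) = 0.
    rewrite trmx_mul.
    by rewrite -[RHS](mulmx0 _ K^T) -(mulmx_coker M) /M !mulmxA.
  move: (B *m K) => W W0.
  (* A diagonal entry of W^T D W is a sum of squares with positive weights, so every square
     vanishes. *)
  apply/eqP/matrixP => i l; rewrite [RHS]mxE.
  have := congr1 (fun A : 'M_#|J| => A l l) W0.
  rewrite mul_mx_diag mxE [RHS]mxE.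
  under eq_bigr => x _ do rewrite !mxE mulrAC -expr2.
  move/eqP; rewrite psumr_eq0 => [/allP/(_ i)|x _]; last first.
    by rewrite mulr_ge0 ?sqr_ge0 ?ler0n.
  rewrite mem_index_enum => /(_ isT); rewrite mulf_eq0 sqrf_eq0 pnatr_eq0.
  rewrite (gtn_eqF (m_gt0 _)) orbF => /eqP; exact.
exists (fun i v => X (enum_rank i) (enum_rank v)) => i j.
have := congr1 (fun A : 'M_(#|I|, #|J|) => A (enum_rank i) (enum_rank j)) eqB.
rewrite !mxE !enum_rankK => ->.
rewrite (reindex _ (onW_bij _ (@enum_val_bij J))) /=.
apply: eq_bigr => v _; rewrite enum_valK; congr (_ * _).
rewrite mxE /weighted_gram natr_sum (reindex _ (onW_bij _ (@enum_val_bij I))) /=.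
apply: eq_bigr => x _; rewrite mul_mx_diag !mxE enum_rankK.
by rewrite !natrM [in RHS](mulrC (m _)%:R).
Qed.

(** Positivity lives in an ordered field, so the rational solution is transported: clear
    denominators, map the integer identity to [k], and divide by the denominator. *)
Lemma incidence_span_gram (k : fieldType) : [pchar k] =i pred0 ->
  exists X : I -> J -> k, forall i j,
  (n i j)%:R = \sum_v X i v * (weighted_gram v j)%:R.
Proof.
move=> char0; have [X eqX] := incidence_sub_gram.
have [d d0 dX] := @common_denominator (I * J)%type (fun p => X p.1 p.2).
pose Y i v : int := numq (d%:~R * X i v).
have eqY i j : d * (n i j)%:R = \sum_v Y i v * (weighted_gram v j)%:R.
  apply: (@intr_inj rat); rewrite rmorphM rmorph_sum /= rmorph_nat eqX mulr_sumr.
  apply: eq_bigr => v _; rewrite rmorphM /= rmorph_nat mulrA.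
  by rewrite (dX (i, v)).
have dk0 : d%:~R != 0 :> k.
  rewrite -[d]intz in d0 *; move: d0; rewrite intz.
  case: d {dX Y eqY} => e; rewrite ?NegzE ?mulrNz ?oppr_eq0 -pmulrn => e0.
    by rewrite (pcharf0P k).1.
  by rewrite (pcharf0P k).1.
exists (fun i v => (Y i v)%:~R / d%:~R) => i j.
apply: (mulfI dk0); have := congr1 (fun z : int => z%:~R : k) (eqY i j).
rewrite rmorphM rmorph_sum /= rmorph_nat => ->; rewrite mulr_sumr.
by apply: eq_bigr => v _; rewrite rmorphM /= rmorph_nat mulrA mulrCA divff ?mulr1.
Qed.

End RationalGram.

(** * The projective center of an algebra with dual bases *)

Section TensorMaps.
Variables (k : fieldType) (A B : algType k).
Local Notation kAB := (cat_alg k (pair_cat A B)).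

Lemma pureM (a a' : A) (b b' : B) :
  pure a b * pure a' b' = pure (a * a') (b * b').
Proof. exact: cat_mul_mor. Qed.

Lemma tensM (a a' : A) (b b' : B) :
  tens a b * tens a' b' = tens (a * a') (b * b').
Proof. by rewrite /tens -pureM; exact/esym/ideal_piM. Qed.

Lemma tensDl (a a' : A) (b : B) : tens (a + a') b = tens a b + tens a' b.
Proof.
by rewrite -[RHS]ideal_piD; apply/ideal_piP/gen_ideal_base; exact: tensor_addl.
Qed.

Lemma tensDr (a : A) (b b' : B) : tens a (b + b') = tens a b + tens a b'.
Proof.
by rewrite -[RHS]ideal_piD; apply/ideal_piP/gen_ideal_base; exact: tensor_addr.
Qed.

Lemma tensZl c (a : A) (b : B) : tens (c *: a) b = c *: tens a b.
Proof.
by rewrite -[RHS]ideal_piZ; apply/ideal_piP/gen_ideal_base; exact: tensor_scalel.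
Qed.

Lemma tensZr c (a : A) (b : B) : tens a (c *: b) = c *: tens a b.
Proof.
by rewrite -[RHS]ideal_piZ; apply/ideal_piP/gen_ideal_base; exact: tensor_scaler.
Qed.

Variables (V : lmodType k) (f : A -> B -> V).
Hypotheses (fl : forall b, linear (f^~ b)) (fr : forall a, linear (f a)).

Definition pure_ext (u : kAB) : V :=
  lin_ext (fun p : mor (pair_cat A B) => f p.1 p.2) u.
HB.instance Definition _ := GRing.isLinear.Build k kAB V _ pure_ext
  (lin_ext_is_linear (fun p : mor (pair_cat A B) => f p.1 p.2)).

Lemma pure_ext_pure a b : pure_ext (pure a b) = f a b.
Proof. exact: (lin_ext_mor (C := pair_cat A B)). Qed.

(** The universal property of the tensor product. Since [pure_ext] is not multiplicative, the
    induction over the two-sided ideal needs the stronger claim that it kills x u y for all x and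
    y. *)
Lemma pure_ext_ideal u : gen_ideal (@tensor_rel k A B) u -> pure_ext u = 0.
Proof.
have fD1 a a' b : f (a + a') b = f a b + f a' b.
  by rewrite -[a]scale1r fl !scale1r.
have fD2 a b b' : f a (b + b') = f a b + f a b'.
  by rewrite -[b]scale1r fr !scale1r.
have f01 b : f 0 b = 0 by apply: (addrI (f 0 b)); rewrite -fD1 !addr0.
have f02 a : f a 0 = 0 by apply: (addrI (f a 0)); rewrite -fD2 !addr0.
have fZ1 c a b : f (c *: a) b = c *: f a b.
  by rewrite -[c *: a]addr0 fl f01 addr0.
have fZ2 c a b : f a (c *: b) = c *: f a b.
  by rewrite -[c *: b]addr0 fr f02 addr0.
suff ext0 : gen_ideal (@tensor_rel k A B) u -> forall x y, pure_ext (x * u * y) = 0.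
  by move/ext0/(_ 1 1); rewrite mul1r mulr1.
elim=> {u} [u|x y|u v _ IHu _ IHv x y|a u _ IHu x y|a u _ IHu x y].
- move=> rel_u x y.
  apply: (eq_linear_cat
    (F := pure_ext \o (cat_mulr y \o cat_mulr u)) (G := \0)) => -[a b].
  apply: (eq_linear_cat
    (F := pure_ext \o cat_mull (pure a b * u)) (G := \0)) => -[a' b'].
  rewrite /= /cat_mull -/(pure a b) -/(pure a' b').
  change (pure_ext (pure a b * u * pure a' b') = 0).
  (* Between pure elements a relation becomes a relation of the same shape, which bilinearity of [f]
     kills. *)
  case: rel_u => [c c' d|c d d'|e c d|e c d];
    rewrite !(mulrBr, mulrDr, mulrBl, mulrDl) -?(scalerAr, scalerAl) !pureM;
    rewrite linearB ?linearD ?linearZ /= !pure_ext_pure.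
  + by rewrite mulrDr mulrDl fD1 -opprD subrr.
  + by rewrite mulrDr mulrDl fD2 -opprD subrr.
  + by rewrite -scalerAr -scalerAl fZ1 scalerN subrr.
  + by rewrite -scalerAr -scalerAl fZ2 scalerN subrr.
- by rewrite mulr0 mul0r linear0.
- by rewrite mulrBr mulrBl linearB /= IHu IHv subrr.
- by rewrite mulrA IHu.
- by rewrite mulrA -mulrA IHu.
Qed.

End TensorMaps.

Lemma projective_regular (R : pzRingType) : projective R^o.
Proof.
move=> M N g f g_surj; have [m gm] := g_surj (f 1).
have lin : linear (fun r : R^o => r *: m) by move=> a x y; rewrite scalerDl -scalerA.
pose h : {linear R^o -> M} :=
  HB.pack (fun r : R^o => r *: m) (GRing.isLinear.Build R R^o M _ _ lin).
exists h => r; transitivity (f (r *: (1 : R^o))); last by congr (f _); exact: mulr1.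
by rewrite /= !linearZ /= gm.
Qed.

Lemma eq_linear_on_mor (k : fieldType) (C : fin_cat) (V : lmodType k)
    (F G : cat_alg k C -> V) :
  linear F -> linear G -> (forall x, F (cat_mor k x) = G (cat_mor k x)) ->
  F =1 G.
Proof.
move=> linF linG.
pose F' : {linear cat_alg k C -> V} :=
  HB.pack F (GRing.isLinear.Build k (cat_alg k C) V _ F linF).
pose G' : {linear cat_alg k C -> V} :=
  HB.pack G (GRing.isLinear.Build k (cat_alg k C) V _ G linG).
exact: (eq_linear_cat (F := F') (G := G')).
Qed.

(** * The Casimir element and the trace map of dual bases *)

Section DualBases.
Variables (k : fieldType) (A : algType k) (t : {linear A -> k^o}).
Variable s : seq (A * A).
Hypothesis expandl : forall x, x = \sum_(p <- s) t (p.2 * x) *: p.1.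
Hypothesis expandr : forall x, x = \sum_(p <- s) t (x * p.1) *: p.2.

(** The trace map of the dual bases; its image is known as the Higman ideal. *)
Definition casimir_sum (c : A) : A := \sum_(p <- s) p.1 * c * p.2.

Lemma casimir_sum_is_linear : linear casimir_sum.
Proof.
move=> c x y; rewrite scaler_sumr -big_split /=; apply: eq_bigr => p _.
by rewrite mulrDr mulrDl -scalerAr -scalerAl.
Qed.
HB.instance Definition _ := GRing.isLinear.Build k A A _ casimir_sum
  casimir_sum_is_linear.

Let E := env_alg A.
Local Notation kAA := (cat_alg k (pair_cat A A^c)).
Local Notation "a (x) b" := (tens (a : A) (b : A^c) : E) (at level 40).

Lemma tens_suml (r : seq (A * A)) (F : A * A -> k) (G : A * A -> A) b :
  (\sum_(p <- r) F p *: G p) (x) b = \sum_(p <- r) F p *: (G p (x) b).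
Proof.
elim: r => [|p r IHr]; last by rewrite !big_cons tensDl tensZl IHr.
by rewrite !big_nil; apply: (addrI (0 (x) b)); rewrite -tensDl !addr0.
Qed.

Lemma tens_sumr (r : seq (A * A)) (F : A * A -> k) (G : A * A -> A) a :
  a (x) (\sum_(p <- r) F p *: G p) = \sum_(p <- r) F p *: (a (x) G p).
Proof.
elim: r => [|p r IHr].
  by rewrite !big_nil; apply: (addrI (a (x) 0)); rewrite -tensDr !addr0.
rewrite !big_cons -IHr; set y := \sum_(_ <- _) _.
transitivity (a (x) (F p *: G p) + a (x) y); first exact: tensDr.
by congr (_ + _); exact: tensZr.
Qed.

(** The Casimir element commutes with [A]: expanding the factor containing [y] in the dual bases
    turns both sides into the double sum of t(q.2 y p.1) times q.1 (x) p.2. *)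
Lemma casimir_tens y :
  \sum_(p <- s) (y * p.1) (x) p.2 = \sum_(p <- s) p.1 (x) (p.2 * y).
Proof.
under eq_bigr => p _ do rewrite (expandl (y * p.1)) tens_suml.
under [RHS]eq_bigr => p _ do rewrite (expandr (p.2 * y)) tens_sumr.
by rewrite exchange_big; apply: eq_bigr => p _; apply: eq_bigr => q _; rewrite mulrA.
Qed.

Definition casimir_map (x : reg_bimod A) : E^o :=
  \sum_(p <- s) ((x : A) * p.1) (x) p.2.

(** For a x b, the factor a x is already on the left, and [casimir_tens] moves b across to the
    second tensor factor, where the opposite product places it on the right. *)
Lemma casimir_map_is_linear : linear casimir_map.
Proof.
have klin : linear (casimir_map : A -> E).
  move=> c x y; rewrite scaler_sumr -big_split /=; apply: eq_bigr => p _.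
  by rewrite mulrDl -scalerAl tensDl tensZl.
have cZ e x : casimir_map (e *: x) = e * casimir_map x.
  rewrite -[e]ideal_reprK; move: (ideal_repr e) => u.
  rewrite [_ *: x]env_act_pi.
  (* Both sides are [k]-linear in the representative of [e], so pure tensors suffice. *)
  apply: (@eq_linear_on_mor k _ E (fun u => casimir_map (pair_act u x))
            (fun u => ideal_pi _ u * casimir_map x)) u.
  - by move=> c u v; rewrite pair_act_is_linear klin.
  - move=> c u v; rewrite ideal_piD ideal_piZ mulrDl.
    by congr (_ + _); exact/esym/quot_scaleAl.
  case=> a b'; pose b : A := b'; rewrite -/b.
  rewrite -[cat_mor k _]/(pure (a : A) (b : A^c)) pair_act_pure.
  rewrite -[ideal_pi _ _]/(a (x) b).
  rewrite mulr_sumr /casimir_map.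
  under eq_bigr do rewrite -mulrA.
  under [RHS]eq_bigr do rewrite tensM.
  transitivity (a * x (x) 1 * \sum_(p <- s) (b * p.1) (x) p.2).
    by rewrite mulr_sumr; apply: eq_bigr => p _; rewrite tensM mul1r !mulrA.
  rewrite casimir_tens mulr_sumr; apply: eq_bigr => p _.
  by rewrite tensM mul1r -mulrA.
move=> e x y; transitivity (casimir_map (e *: x) + casimir_map y).
  have := klin 1 (e *: x) y; rewrite !scale1r; exact.
by congr (_ + _); exact: cZ.
Qed.

HB.instance Definition _ := GRing.isLinear.Build E (reg_bimod A) E^o _
  casimir_map casimir_map_is_linear.

Lemma env_act_tens1 a : (a (x) 1) *: (1 : reg_bimod A) = a.
Proof. by rewrite [LHS]env_act_tens !mulr1. Qed.

Definition act_on (c : reg_bimod A) (e : E^o) : reg_bimod A := (e : E) *: c.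

Lemma act_on_is_linear c : linear (act_on c).
Proof. by move=> e x y; rewrite /act_on scalerDl -scalerA. Qed.
HB.instance Definition _ c := GRing.isLinear.Build E E^o (reg_bimod A) _
  (act_on c) (act_on_is_linear c).

Lemma act_on_tens c a b : act_on c (a (x) b) = (a : A) * c * b.
Proof. exact: env_act_tens. Qed.

(** Apply the bimodule map [act_on c] to [casimir_tens]. *)
Lemma central_casimir_sum c : central (casimir_sum c).
Proof.
move=> a; rewrite mulr_sumr mulr_suml.
have := congr1 (act_on c) (casimir_tens a); rewrite !linear_sum /= => eqg.
transitivity (\sum_(p <- s) act_on c (p.1 (x) (p.2 * a))).
  by apply: eq_bigr => p _; rewrite [RHS]act_on_tens mulrA.
by rewrite -eqg; apply: eq_bigr => p _; rewrite [LHS]act_on_tens !mulrA.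
Qed.

(* Lifting g : P -> A along the epimorphism A^e -> A makes z factor through A^e,
   so z is the value at 1 of an element u of A^e with a u = u a; expanding the
   first tensor factors of u in the basis p.1 gives z = sum p.1 w p.2. *)
Theorem projective_centerP z :
  projective_center z <-> exists c, z = casimir_sum c.
Proof.
split=> [[_ [P [f [g [projP fgz]]]]]|[c ->]]; last first.
  split; first exact: central_casimir_sum.
  (* Multiplication by the trace of [c] is the composite of [casimir_map], from A to A^e, and
     [act_on c], from A^e back to A. *)
  exists E^o, casimir_map, (act_on c); split=> [|a]; first exact: projective_regular.
  rewrite central_casimir_sum mulr_sumr linear_sum; apply: eq_bigr => p _.
  by rewrite [LHS]act_on_tens !mulrA.
have [|h hg] := projP _ _ (act_on 1) g.
  by move=> y; exists ((y : A) (x) 1); exact: env_act_tens1.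
pose u := h (f 1); pose u0 := ideal_repr (u : E).
have hfZ (e : E) : h (f (e *: (1 : reg_bimod A))) = e *: (u : E^o).
  exact: etrans (congr1 h (linearZ_LR f e _)) (linearZ_LR h e _).
(* Both sides are the image under h f of the element a of A, which is (a (x) 1) 1 as well as (1 (x)
   a) 1. *)
have casu a : (a (x) 1) * u = ((1 : A) (x) a) * u.
  apply: etrans (esym (hfZ (a (x) 1))) (etrans _ (hfZ ((1 : A) (x) a))).
  by congr (h (f _)); rewrite [LHS]env_act_tens [RHS]env_act_tens !mulr1 !mul1r.
(* [L] contracts the first tensor factor with [t]; the witness is the contraction of [u]. *)
pose tr (a : A) (b : A^c) : A := t a *: (b : A).
have fl b : linear (tr^~ b).
  by move=> c x y; rewrite /tr linearD linearZ scalerDl scalerA.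
have fr a : linear (tr a).
  by move=> c x y; rewrite /tr scalerDr !scalerA mulrC.
pose L : {linear kAA -> A} := pure_ext tr.
have LE a (b : A^c) : L (pure a b) = t a *: (b : A) by exact: pure_ext_pure.
exists (L u0).
have -> : z = pair_act u0 1.
  rewrite -[z]mulr1 -fgz -hg -[LHS]/(env_act u 1) -env_act_pi.
  by rewrite ideal_reprK.
have casL a : L (pure a (1 : A^c) * u0) = L (pure (1 : A) (a : A^c) * u0).
  apply/eqP; rewrite -subr_eq0 -linearB; apply/eqP; apply: (pure_ext_ideal fl fr).
  apply/ideal_piP; rewrite !ideal_piM ideal_reprK; exact: casu.
(* The dual bases recover the product a b of a pure tensor from its contractions. For [u0], [casL]
   then moves p.2 to the second factor and [absorb] takes it out on the right. *)
have expand (v : kAA) :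
    pair_act v 1 = \sum_(p <- s) p.1 * L (pure p.2 (1 : A^c) * v).
  apply: (@eq_linear_on_mor k _ A (fun v => pair_act v 1)
    (fun v => \sum_(p <- s) p.1 * L (pure p.2 (1 : A^c) * v))) v.
  - by move=> c v w; rewrite pair_act_is_linear.
  - move=> c v w; rewrite scaler_sumr -big_split; apply: eq_bigr => p _.
    by rewrite mulrDr -scalerAr linearP mulrDr -scalerAr.
  case=> a b; rewrite -[cat_mor k _]/(pure a b) pair_act_pure mulr1.
  rewrite {1}(expandl a) mulr_suml; apply: eq_bigr => p _.
  by rewrite pureM LE mul1r -scalerAr -scalerAl.
have absorb a (v : kAA) : L (pure (1 : A) (a : A^c) * v) = L v * a.
  apply: (@eq_linear_on_mor k _ A (fun v => L (pure (1 : A) (a : A^c) * v))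
    (fun v => L v * a)) v.
  - by move=> c v w; rewrite mulrDr -scalerAr linearP.
  - by move=> c v w; rewrite linearP mulrDl -scalerAl.
  case=> b b'; rewrite -[cat_mor k _]/(pure b b') pureM !LE mul1r.
  by rewrite -scalerAl.
by rewrite expand; apply: eq_bigr => p _; rewrite casL absorb mulrA.
Qed.

End DualBases.

(** * Cycles of arrows around a vertex *)

Section ArrowOrbits.
Variable G : brauer_graph.
Local Notation Q := (brauer_quiver G).
Local Notation sg := (@sigma G).
Local Notation tgt := (@tgt Q).
Local Notation src := (@src Q).
Implicit Types (a b : arrow G) (s : seq (arrow G)).

(** The length of the path C_a^m(C_a). *)
Definition cycle_len a : nat := (fingraph.order sg a * cycle_mult a)%N.

Lemma sigma_inj : injective sg.
Proof. by move=> a b /(congr1 val) /= /perm_inj/val_inj. Qed.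

Lemma base_iter_sigma i a : base (val (iter i sg a)) = base (val a).
Proof. by elim: i => //= i IHi; rewrite base_rotV. Qed.

Lemma cycle_len_iter i a : cycle_len (iter i sg a) = cycle_len a.
Proof.
congr (_ * _)%N; last by rewrite /cycle_mult base_iter_sigma.
elim: i => //= i <-; apply/esym/eq_card => x; exact: same_fconnect1 sigma_inj _ x.
Qed.

Lemma iter_cycle_len a : iter (cycle_len a) sg a = a.
Proof.
rewrite /cycle_len mulnC; elim: (cycle_mult a) => //= n IHn.
by rewrite mulSn iterD IHn fingraph.iter_order //; exact: sigma_inj.
Qed.

Lemma cycle_len_gt0 a : (0 < cycle_len a)%N.
Proof. by rewrite muln_gt0 fingraph.order_gt0 mult_gt0. Qed.

Lemma tgt_sigma a : tgt (sg a) = src a.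
Proof. by rewrite /= permKV. Qed.

(* The sequences of arrows of the paths C_a^m(C_a). *)
Definition full_cycle s : bool :=
  if s is a :: _ then s == traject sg a (cycle_len a) else false.

Lemma full_cycle_traject a j :
  full_cycle (traject sg a j) = (j == cycle_len a).
Proof.
case: j => [|j]; first by rewrite /= eq_sym (gtn_eqF (cycle_len_gt0 a)).
rewrite [LHS]/=; apply/eqP/eqP => [/(congr1 size)|eqj].
  by rewrite size_traject /= size_traject.
by rewrite -eqj.
Qed.

(** The arrow [a] is an iterate of the first arrow [c] of the full cycle, and [cycle_len] is
    constant on orbits. For relations (a) and (b) this rules out full cycles that properly extend
    C_a^m(C_a). *)
Lemma full_cycle_mid s s' a j : (0 < j)%N ->
  full_cycle (s ++ traject sg a j ++ s') -> (size s + j + size s' = cycle_len a)%N.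
Proof.
case: j => // j _; set S := s ++ _.
(* The empty sequence is not a full cycle, so there any witness serves. *)
have [c] : exists c, full_cycle S -> S = traject sg c (cycle_len c).
  by case eqS: S => [|c S']; [exists a|exists c => /eqP].
move=> eqS /eqS {}eqS; have sizeS := congr1 size eqS.
rewrite size_traject !size_cat size_traject addnA in sizeS; rewrite sizeS.
have lt_s : (size s < cycle_len c)%N.
  by rewrite -sizeS -addnA -[leqLHS]addn1 leq_add2l.
have := nth_traject sg lt_s c; rewrite -eqS nth_cat ltnn subnn /= => ->.
by rewrite cycle_len_iter.
Qed.

Lemma full_cycle_succ s s' a b : full_cycle (s ++ a :: b :: s') -> b = sg a.
Proof.
set S := s ++ _; have [c] : exists c, full_cycle S -> S = traject sg c (cycle_len c).
  by case eqS: S => [|c S']; [exists a|exists c => /eqP].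
move=> eqS /eqS {}eqS; have sizeS := congr1 size eqS.
rewrite size_traject !size_cat /= in sizeS.
have nthS i : (i < cycle_len c)%N -> nth c S i = iter i sg c.
  by move=> ltic; rewrite eqS nth_traject.
have lt_s : ((size s).+1 < cycle_len c)%N.
  by rewrite -sizeS !addnS !ltnS leq_addr.
have := nthS _ lt_s; have := nthS _ (ltnW lt_s).
rewrite !nth_cat ltnn subnn [(_.+1 < size s)%N]ltnNge leqnSn subSnn /=.
by move=> <- <-.
Qed.

End ArrowOrbits.

(** * Incidence numbers and counting along cycles *)

Section Incidence.
Variable G : brauer_graph.
Local Notation Q := (brauer_quiver G).
Local Notation H := (half_edge G).
Local Notation sg := (@sigma G).
Local Notation rot := (Defs.rot G).
Local Notation tgt := (@tgt Q).
Implicit Types (x : vertex G) (e v : edge G) (h : H) (a b : arrow G).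

(** The entries of N. Half-edges are counted, so a loop at [x] contributes 2. *)
Definition incidence x e : nat := #|[set h | (base h == x) && (edge_of h == e)]|.

Lemma base_rot h : base (rot h) = base h.
Proof. by rewrite -[in RHS](permK rot h) base_rotV. Qed.

Lemma incidenceE x e :
  incidence x e = (\sum_(h | base h == x) (e == edge_of h))%N.
Proof.
rewrite /incidence -sum1dep_card big_mkcondr; apply: eq_bigr => h _.
by rewrite eq_sym; case: eqP.
Qed.

Lemma sum_arrow (V : nmodType) (F : H -> V) :
  \sum_(a : arrow G) F (val a) = \sum_(h | is_arrow h) F h.
Proof.
rewrite [RHS](reindex_omap (val : arrow G -> H) insub) => [|h arr_h].
  by apply: eq_bigl => a; rewrite valK eqxx (valP a).
by rewrite insubT.
Qed.

(** The only delicate case is the arrow kept for a single truncated edge: its base carries just one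
    half-edge, hence [h] is that half-edge. *)
Lemma is_arrow_base a h : base h = base (val a) -> is_arrow h.
Proof.
case: a => h' /= arr_h' eq_b; case tr: (truncated (base h')).
  by rewrite (truncated_half_edge tr eq_b).
by rewrite /is_arrow eq_b tr.
Qed.

(** The cycles of [rot] are the sets of half-edges at a vertex. As [sigma] inverts [rot], a power of
    [rot] leading from [a] to [b] is a power of [sigma] leading from [b] to [a]. *)
Lemma fconnect_sigma a b : fconnect sg a b = (base (val b) == base (val a)).
Proof.
apply/idP/eqP => [/iter_findex <-|eq_b]; first exact: base_iter_sigma.
have /porbitP[i eq_i] : val b \in porbit rot (val a).
  by apply/mem_half_edges_rot.
rewrite fconnect_sym; last exact: sigma_inj.
have -> : a = iter i sg b; last exact: fconnect_iter.
apply: val_inj; have -> : val (iter i sg b) = (rot^-1 ^+ i)%g (val b).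
  by elim: i {eq_i} => [|i IHi]; rewrite ?perm1 // expgSr permM -IHi.
by rewrite eq_i expgVn permK.
Qed.

Lemma sum_iter_sigma (F : arrow G -> nat) a n :
  (\sum_(0 <= j < n) F (iter j sg a) = \sum_(b <- traject sg a n) F b)%N.
Proof.
elim: n a => [|n IHn] a; first by rewrite big_geq // big_nil.
rewrite trajectS big_cons -IHn big_nat_recl //; congr (_ + _)%N.
by apply: eq_bigr => j _; rewrite iterSr.
Qed.

Lemma sum_orbit (F : arrow G -> nat) a :
  (\sum_(b <- fingraph.orbit sg a) F b = \sum_(b | base (val b) == base (val a)) F b)%N.
Proof.
rewrite big_uniq ?orbit_uniq //; apply: eq_bigl => b.
by rewrite -fconnect_orbit fconnect_sigma.
Qed.

(** The path C_a^m(C_a) runs through the [sigma]-orbit of [a], that is, all arrows at its base,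
    exactly [cycle_mult a] times. *)
Lemma sum_cycle (F : arrow G -> nat) a :
  (\sum_(0 <= j < cycle_len a) F (iter j sg a) =
   cycle_mult a * \sum_(b | base (val b) == base (val a)) F b)%N.
Proof.
rewrite sum_iter_sigma /cycle_len; elim: (cycle_mult a) => [|n IHn].
  by rewrite muln0 big_nil.
rewrite mulnS trajectD big_cat /= fingraph.iter_order; last exact: sigma_inj.
by rewrite IHn mulSn -sum_orbit.
Qed.

Lemma reindex_rot (V : nmodType) (F : H -> V) x :
  \sum_(h | base h == x) F (rot h) = \sum_(h | base h == x) F h.
Proof.
rewrite [RHS](reindex_inj (@perm_inj _ rot)).
by apply: eq_bigl => h; rewrite base_rot.
Qed.

(** The target of an arrow is the edge of the rotated half-edge, and [rot] permutes the half-edges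
    at the base; so [sum_cycle] counts half-edges of [v]. *)
Lemma count_tgt_cycle a v :
  (\sum_(0 <= j < cycle_len a) (v == tgt (iter j sg a)) =
   cycle_mult a * incidence (base (val a)) v)%N.
Proof.
rewrite (sum_cycle (fun b => (v == tgt b) : nat)); congr (_ * _)%N.
rewrite incidenceE -(reindex_rot (fun h => (v == edge_of h) : nat)).
rewrite big_mkcond (sum_arrow (fun h =>
  if base h == base (val a) then (v == edge_of (rot h) : nat) else 0%N)).
rewrite -big_mkcondr; apply: eq_bigl => h.
case: eqP => [eq_b|]; last by rewrite andbF.
by rewrite (is_arrow_base eq_b).
Qed.

Lemma card_edge_of v : (\sum_h (v == edge_of h) = 2)%N.
Proof.
case: v => E EP; have /imsetP[h0 _ eqE] := EP.
have edge_ofE h : (Edge EP == edge_of h) = (h \in [set h0; flip h0]).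
  rewrite -val_eqE /= eqE !inE; apply/eqP/orP => [/setP/(_ h)|].
    by rewrite !inE eqxx orTb => /orP.
  by case=> /eqP ->; rewrite /edge_set ?flipK // setUC.
under eq_bigr do rewrite edge_ofE.
by rewrite -big_mkcond sum1_card cards2 eq_sym flip_neq.
Qed.

Lemma not_arrow_base h : ~~ is_arrow h ->
  [/\ mult (base h) = 1%N, rot h = h &
      forall v, incidence (base h) v = (v == edge_of h)].
Proof.
rewrite /is_arrow negb_or negbK => /andP[trunc _]; split.
- by move: trunc; rewrite /truncated muln_eq1 => /andP[/eqP].
- exact: (truncated_half_edge trunc (base_rot h)).
move=> v; rewrite incidenceE (big_pred1 h) // => h'.
apply/eqP/eqP => [|-> //]; exact: truncated_half_edge.
Qed.

Variables (k : fieldType) (V : lmodType k) (s : edge G -> V).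

(** With the socle elements for [s] this is p_x^(m_x), by [vertex_powerE]. *)
Definition incident_sum x : V := \sum_(h | base h == x) s (edge_of h).

Lemma incident_sumE x : incident_sum x = \sum_e (incidence x e)%:R *: s e.
Proof.
rewrite /incident_sum (partition_big (@edge_of G) predT) //=.
apply: eq_bigr => e _; rewrite scaler_nat /incidence -sumr_const.
by apply: eq_big => [h|h /andP[_ /eqP ->]]; rewrite ?inE.
Qed.

(** With the socle elements for [s], the left side is the trace of the idempotent at [v]. The two
    half-edges of [v] supply the two copies of [s v], written as the sum of [U]. At an arrow, [U] is
    the missing term j = 0 that completes the sum to [W]; at a half-edge without arrow, [U] equals
    [W]. Grouping [W] by base vertices gives the right side. *)
Lemma cycle_sum_incident v :
  s v *+ 2 +
    \sum_a \sum_(1 <= j < cycle_len a) (v == tgt (iter j sg a))%:R *: s (tgt a) =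
  \sum_x (mult x * incidence x v)%:R *: incident_sum x.
Proof.
pose U h : V := (v == edge_of (rot h))%:R *: s (edge_of (rot h)).
pose W h : V := (mult (base h) * incidence (base h) v)%:R *: s (edge_of (rot h)).
have sumU : \sum_h U h = s v *+ 2.
  rewrite -(card_edge_of v) -sumrMnr [RHS](reindex_inj (@perm_inj _ rot)).
  by apply: eq_bigr => h _; rewrite /U; case: eqP => [->|_]; rewrite ?scale1r ?scale0r.
have -> : \sum_a \sum_(1 <= j < cycle_len a) (v == tgt (iter j sg a))%:R *: s (tgt a) =
    \sum_(h | is_arrow h) W h - \sum_(h | is_arrow h) U h.
  rewrite -!sum_arrow -sumrB; apply: eq_bigr => a _.
  apply/eqP; rewrite eq_sym subr_eq; apply/eqP.
  rewrite /W -[mult _]/(cycle_mult a) -count_tgt_cycle natr_sum scaler_suml.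
  by rewrite big_ltn ?cycle_len_gt0 // addrC.
rewrite -sumU (bigID (@is_arrow G)) /= addrAC [X in X + _]addrC subrK.
have -> : \sum_(h | ~~ is_arrow h) U h = \sum_(h | ~~ is_arrow h) W h.
  apply: eq_bigr => h /not_arrow_base[m1 rot_h inc]; rewrite /U /W m1 inc rot_h.
  by rewrite mul1n.
have -> : \sum_(h | is_arrow h) W h + \sum_(h | ~~ is_arrow h) W h = \sum_h W h.
  by rewrite [RHS](bigID (@is_arrow G)).
rewrite (partition_big (@base G) predT) //=; apply: eq_bigr => x _.
rewrite /incident_sum -(reindex_rot (fun h => s (edge_of h))) scaler_sumr.
by apply: eq_bigr => h /eqP <-.
Qed.

End Incidence.

(** * The trace map of a Brauer graph algebra *)

Lemma expr_sum_orthogonal (R : pzRingType) (I : finType) (P : pred I)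
    (F : I -> R) n :
  (forall i j, i != j -> F i * F j = 0) -> (0 < n)%N ->
  (\sum_(i | P i) F i) ^+ n = \sum_(i | P i) F i ^+ n.
Proof.
move=> orthF; case: n => // n _; elim: n => [|n IHn]; first by [].
rewrite exprS IHn mulr_suml; apply: eq_bigr => i Pi.
rewrite mulr_sumr (bigD1 i) //= -exprS big1 ?addr0 // => j /andP[_ nji].
by rewrite exprS mulrA orthF ?mul0r // eq_sym.
Qed.

Section CycleAlgebra.
Variables (k : fieldType) (G : brauer_graph) (A : algType k).
Local Notation Q := (brauer_quiver G).
Local Notation sg := (@sigma G).
Local Notation tgt := (@tgt Q).
Implicit Types (v w e f : edge G) (a b : arrow G) (i j : nat).

(* The multiplication rules of the Brauer graph algebra: rot_path a j stands for
   the path a sigma(a) ... sigma^(j-1)(a), and tr for the symmetrizing form. *)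
Variables (idem socle : edge G -> A) (rot_path : arrow G -> nat -> A).
Variable tr : {linear A -> k^o}.
Hypothesis idemM : forall e f, idem e * idem f = if e == f then idem e else 0.
Hypothesis idem_rot_path : forall e a j, (0 < j)%N ->
  idem e * rot_path a j = if e == tgt a then rot_path a j else 0.
Hypothesis rot_path_idem : forall e a j, (0 < j)%N ->
  rot_path a j * idem e = if e == tgt (iter j sg a) then rot_path a j else 0.
Hypothesis rot_pathM : forall a i b j, (0 < i)%N -> (0 < j)%N ->
  rot_path a i * rot_path b j =
  if b == iter i sg a then rot_path a (i + j) else 0.
Hypothesis rot_path_gt : forall a j, (cycle_len a < j)%N -> rot_path a j = 0.
Hypothesis rot_path_cycle_len : forall a, rot_path a (cycle_len a) = socle (tgt a).
Hypothesis tr_idem : forall e, tr (idem e) = 0.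
Hypothesis tr_rot_path : forall a j, (0 < j)%N ->
  tr (rot_path a j) = (j == cycle_len a)%:R.
Hypothesis spanning_ind : forall P : A -> Prop,
  (forall c x y, P x -> P y -> P (c *: x + y)) ->
  (forall e, P (idem e)) ->
  (forall a j, (0 < j <= cycle_len a)%N -> P (rot_path a j)) ->
  forall x, P x.

Lemma eq_on_spanning (F H : A -> A) :
  linear F -> linear H -> (forall e, F (idem e) = H (idem e)) ->
  (forall a j, (0 < j <= cycle_len a)%N -> F (rot_path a j) = H (rot_path a j)) ->
  F =1 H.
Proof.
move=> lF lH FH_idem FH_path; apply: spanning_ind => // c x y Fx Fy.
by rewrite lF lH Fx Fy.
Qed.

Lemma socle_rot_path e : exists2 a, tgt a = e & socle e = rot_path a (cycle_len a).
Proof.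
by have [a <-] := arrow_tgt_surj e; exists a => //; rewrite rot_path_cycle_len.
Qed.

Lemma idem_socle f e : idem f * socle e = if f == e then socle e else 0.
Proof. by have [a <- ->] := socle_rot_path e; rewrite idem_rot_path ?cycle_len_gt0. Qed.

Lemma socle_idem e f : socle e * idem f = if f == e then socle e else 0.
Proof.
have [a <- ->] := socle_rot_path e.
by rewrite rot_path_idem ?cycle_len_gt0 // iter_cycle_len.
Qed.

Lemma rot_path_socle a j e : (0 < j)%N -> rot_path a j * socle e = 0.
Proof.
have [b <- ->] := socle_rot_path e => j0; rewrite rot_pathM ?cycle_len_gt0 //.
case: eqP => // ->; rewrite cycle_len_iter rot_path_gt //.
by rewrite -[ltnLHS]add0n ltn_add2r.
Qed.

Lemma socle_rot_path0 e a j : (0 < j)%N -> socle e * rot_path a j = 0.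
Proof.
have [b <- ->] := socle_rot_path e => j0; rewrite rot_pathM ?cycle_len_gt0 //.
case: eqP => // _; rewrite rot_path_gt //.
by rewrite -[ltnLHS]addn0 ltn_add2l.
Qed.

Lemma tr_socle e : tr (socle e) = 1.
Proof.
have [a _ ->] := socle_rot_path e.
by rewrite tr_rot_path ?cycle_len_gt0 // eqxx.
Qed.

Lemma tr_rot_pathM a i b j : (0 < i)%N -> (0 < j)%N ->
  tr (rot_path a i * rot_path b j) =
  ((b == iter i sg a) && (i + j == cycle_len a)%N)%:R.
Proof.
move=> i0 j0; rewrite rot_pathM //; case: eqP => _; last exact: linear0.
by rewrite tr_rot_path // addn_gt0 i0.
Qed.

(** Idempotents and socle elements are dual to each other, and a shorter path is dual to its
    complement in the full cycle. The index stops before [cycle_len a] because full cycles are socle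
    elements, already listed once per edge. *)
Definition dual_pairs : seq (A * A) :=
  [seq (idem e, socle e) | e <- index_enum (edge G)] ++
  [seq (socle e, idem e) | e <- index_enum (edge G)] ++
  [seq (rot_path a j, rot_path (iter j sg a) (cycle_len a - j))
     | a <- index_enum (arrow G), j <- index_iota 1 (cycle_len a)].

Lemma big_dual_pairs (V : nmodType) (F : A -> A -> V) :
  \sum_(p <- dual_pairs) F p.1 p.2 =
  \sum_e F (idem e) (socle e) + \sum_e F (socle e) (idem e) +
  \sum_a \sum_(1 <= j < cycle_len a)
    F (rot_path a j) (rot_path (iter j sg a) (cycle_len a - j)).
Proof. by rewrite !big_cat /= !big_map big_allpairs_dep addrA. Qed.

Lemma dual_pairs_expandl x : x = \sum_(p <- dual_pairs) tr (p.2 * x) *: p.1.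
Proof.
move: x; apply: eq_on_spanning => //.
- move=> c x y; rewrite scaler_sumr -big_split; apply: eq_bigr => p _ /=.
  by rewrite mulrDr -scalerAr linearP scalerDl scalerA.
- move=> f; rewrite (big_dual_pairs (fun x y => tr (y * _) *: x)).
  have -> : \sum_e tr (socle e * idem f) *: idem e = idem f.
    rewrite (bigD1 f) //= socle_idem eqxx tr_socle scale1r.
    rewrite big1 ?addr0 // => e ne.
    by rewrite socle_idem eq_sym (negPf ne) linear0 scale0r.
  have -> : \sum_e tr (idem e * idem f) *: socle e = 0.
    apply: big1 => e _; rewrite idemM.
    by case: eqP => _; rewrite ?tr_idem ?linear0 scale0r.
  rewrite big1 ?addr0 // => a _; rewrite big_nat big1 // => j /andP[j0 jlt].
  have lj : (0 < cycle_len a - j)%N by rewrite subn_gt0.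
  rewrite rot_path_idem //; case: eqP => _; last by rewrite linear0 scale0r.
  rewrite tr_rot_path // cycle_len_iter ltn_eqF ?scale0r //.
  by rewrite ltn_subrL j0 cycle_len_gt0.
- move=> a i /andP[i0 le_i]; rewrite (big_dual_pairs (fun x y => tr (y * _) *: x)).
  have -> : \sum_e tr (socle e * rot_path a i) *: idem e = 0.
    by apply: big1 => e _; rewrite socle_rot_path0 // linear0 scale0r.
  have -> : \sum_e tr (idem e * rot_path a i) *: socle e =
      if i == cycle_len a then rot_path a i else 0.
    rewrite (bigD1 (tgt a)) //= big1 => [|e ne]; last first.
      by rewrite idem_rot_path // (negPf ne) linear0 scale0r.
    rewrite addr0 idem_rot_path // eqxx tr_rot_path //.
    by case: eqP => [->|_]; rewrite ?scale0r // scale1r rot_path_cycle_len.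
  (* The complement of (b, j) pairs to 1 with (a, i) exactly when the two indices agree. *)
  have trE b j : (0 < j < cycle_len b)%N ->
      tr (rot_path (iter j sg b) (cycle_len b - j) * rot_path a i) =
      ((b == a) && (j == i))%:R.
    move=> /andP[j0 jlt]; rewrite tr_rot_pathM ?subn_gt0 // -iterD.
    rewrite subnK ?(ltnW jlt) // iter_cycle_len cycle_len_iter eq_sym.
    congr (_ && _)%:R.
    by rewrite -[eqbRHS](subnK (ltnW jlt)) eqn_add2l eq_sym.
  rewrite (bigD1 a) //= [X in _ + (_ + X)]big1 ?addr0; last first.
    move=> b nba; rewrite big_nat big1 // => j jlt.
    by rewrite trE // (negPf nba) scale0r.
  (* A full cycle is recovered by the pair of a socle element and an idempotent, a shorter path by
     its own pair; exactly one of the two contributes. *)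
  rewrite (eq_big_nat _ _ (F2 := fun j => if j == i then rot_path a j else 0)).
    rewrite -big_mkcond big_nat1_eq i0 /=.
    by case: ltngtP le_i => // _ _; rewrite ?add0r ?addr0.
  move=> j jlt; rewrite trE // eqxx.
  by case: eqP => [->|_]; rewrite ?scale1r ?scale0r.
Qed.

Lemma dual_pairs_expandr x : x = \sum_(p <- dual_pairs) tr (x * p.1) *: p.2.
Proof.
move: x; apply: eq_on_spanning => //.
- move=> c x y; rewrite scaler_sumr -big_split; apply: eq_bigr => p _ /=.
  by rewrite mulrDl -scalerAl linearP scalerDl scalerA.
- move=> f; rewrite (big_dual_pairs (fun x y => tr (_ * x) *: y)).
  have -> : \sum_e tr (idem f * idem e) *: socle e = 0.
    apply: big1 => e _; rewrite idemM.
    by case: eqP => _; rewrite ?tr_idem ?linear0 scale0r.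
  have -> : \sum_e tr (idem f * socle e) *: idem e = idem f.
    rewrite (bigD1 f) //= idem_socle eqxx tr_socle scale1r.
    rewrite big1 ?addr0 // => e ne.
    by rewrite idem_socle eq_sym (negPf ne) linear0 scale0r.
  rewrite add0r big1 ?addr0 // => a _; rewrite big_nat big1 // => j /andP[j0 jlt].
  rewrite idem_rot_path //; case: eqP => _; last by rewrite linear0 scale0r.
  by rewrite tr_rot_path // ltn_eqF ?scale0r.
- move=> a i /andP[i0 le_i]; rewrite (big_dual_pairs (fun x y => tr (_ * x) *: y)).
  have -> : \sum_e tr (rot_path a i * socle e) *: idem e = 0.
    by apply: big1 => e _; rewrite rot_path_socle // linear0 scale0r.
  have -> : \sum_e tr (rot_path a i * idem e) *: socle e =
      if i == cycle_len a then rot_path a i else 0.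
    rewrite (bigD1 (tgt (iter i sg a))) //= big1 => [|e ne]; last first.
      by rewrite rot_path_idem // (negPf ne) linear0 scale0r.
    rewrite addr0 rot_path_idem // eqxx tr_rot_path //.
    case: eqP => [->|_]; rewrite ?scale0r // scale1r rot_path_cycle_len.
    by rewrite iter_cycle_len.
  (* Here the path (a, i) is the second component of the pair indexed by [iter i sg a] and
     [cycle_len a - i]. *)
  rewrite addr0 (bigD1 (iter i sg a)) //= [X in _ + (_ + X)]big1 ?addr0; last first.
    move=> b nba; rewrite big_nat big1 // => j /andP[j0 _].
    by rewrite tr_rot_pathM // (negPf nba) scale0r.
  rewrite cycle_len_iter.
  rewrite (eq_big_nat _ _
    (F2 := fun j => if j == (cycle_len a - i)%N then rot_path a i else 0)).
    rewrite -big_mkcond big_nat1_eq subn_gt0 ltn_subrL i0 cycle_len_gt0 andbT.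
    by case: ltngtP le_i => // _ _; rewrite ?add0r ?addr0.
  move=> j /andP[j0 jlt]; rewrite tr_rot_pathM // eqxx -iterD /=.
  rewrite -{1}(subnKC le_i) eqn_add2l.
  case: eqP => [ej|_]; last by rewrite scale0r.
  by rewrite scale1r {1}ej subnK // iter_cycle_len ej subKn.
Qed.

Local Notation tau := (casimir_sum dual_pairs).

(** Inserting a nontrivial path between a path and its complement gives 0 or a path longer than a
    full cycle, which vanishes too. *)
Lemma casimir_sum_rot_path a j : (0 < j)%N -> tau (rot_path a j) = 0.
Proof.
move=> j0; rewrite /casimir_sum (big_dual_pairs (fun x y => x * _ * y)).
rewrite big1 ?add0r => [|e _]; last by rewrite -mulrA rot_path_socle // mulr0.
rewrite big1 ?add0r => [|e _]; last by rewrite socle_rot_path0 // mul0r.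
apply: big1 => b _; rewrite big_nat; apply: big1 => i /andP[i0 ilt].
rewrite rot_pathM //; case: eqP => _; last by rewrite mul0r.
rewrite rot_pathM ?addn_gt0 ?i0 ?subn_gt0 //; case: eqP => // _.
by rewrite addnAC subnKC ?(ltnW ilt) // rot_path_gt // -[ltnLHS]addn0 ltn_add2l.
Qed.

(** The two pairs of an idempotent and a socle element at [v] give the two copies; each shorter path
    with source [v] closes up with its complement to a socle element. *)
Lemma casimir_sum_idem v :
  tau (idem v) = socle v *+ 2 +
    \sum_a \sum_(1 <= j < cycle_len a) (v == tgt (iter j sg a))%:R *: socle (tgt a).
Proof.
rewrite /casimir_sum (big_dual_pairs (fun x y => x * _ * y)) mulr2n.
congr (_ + _ + _).
- rewrite (bigD1 v) //= idemM eqxx idem_socle eqxx big1 ?addr0 // => e ne.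
  by rewrite idemM (negPf ne) mul0r.
- rewrite (bigD1 v) //= socle_idem eqxx socle_idem eqxx big1 ?addr0 // => e ne.
  by rewrite socle_idem eq_sym (negPf ne) mul0r.
apply: eq_bigr => a _; apply: eq_big_nat => j /andP[j0 jlt].
rewrite rot_path_idem //; case: eqP => _; last by rewrite mul0r scale0r.
by rewrite rot_pathM ?subn_gt0 // eqxx subnKC ?(ltnW jlt) // rot_path_cycle_len scale1r.
Qed.

Lemma rot_path_orderX a n : (0 < n)%N ->
  rot_path a (fingraph.order sg a * n) = rot_path a (fingraph.order sg a) ^+ n.
Proof.
have o0 := fingraph.order_gt0 sg a; case: n => // n _.
elim: n => [|n IHn]; first by rewrite muln1.
rewrite mulnS exprS -IHn rot_pathM ?muln_gt0 ?o0 //.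
by rewrite fingraph.iter_order ?eqxx //; exact: sigma_inj.
Qed.

(** The counterpart of [vertex_elt] in the axiomatic setting; [vertex_power_elt] identifies the
    two. *)
Definition vertex_power (x : vertex G) : A :=
  if truncated x then
    if [pick h | base h == x] is Some h then socle (edge_of h) else 0
  else (\sum_(a : arrow G | base (val a) == x)
          rot_path a (fingraph.order sg a)) ^+ mult x.

(** Distinct rotations of the cycle at [x] are orthogonal, since a full turn can only be continued
    by its own first arrow. The power is thus taken termwise, and each term becomes the socle
    element at the target of its arrow. *)
Lemma vertex_powerE x : vertex_power x = incident_sum socle x.
Proof.
rewrite /vertex_power /incident_sum; case trunc: (truncated x).
  case: pickP => [h /eqP base_h|no_h]; last by rewrite big_pred0.
  rewrite (big_pred1 h) // => h'; apply/eqP/eqP => [eqx|-> //].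
  by apply: truncated_half_edge; rewrite base_h.
rewrite expr_sum_orthogonal ?mult_gt0 // => [|a b nab]; last first.
  rewrite rot_pathM ?fingraph.order_gt0 // fingraph.iter_order; last exact: sigma_inj.
  by rewrite eq_sym (negPf nab).
rewrite -(reindex_rot (fun h => socle (edge_of h))) [LHS]big_mkcond.
transitivity (\sum_(a : arrow G)
  if base (val a) == x then socle (edge_of (Defs.rot G (val a))) else 0).
  apply: eq_bigr => a _; case: eqP => // <-.
  by rewrite -rot_path_orderX ?mult_gt0 // rot_path_cycle_len.
rewrite (sum_arrow (fun h =>
  if base h == x then socle (edge_of (Defs.rot G h)) else 0)).
rewrite -big_mkcondr; apply: eq_bigl => h.
by case: eqP => [eqx|]; rewrite ?andbF // /is_arrow eqx trunc.
Qed.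

Lemma casimir_sum_idemE v :
  tau (idem v) = \sum_x (mult x * incidence x v)%:R *: vertex_power x.
Proof.
rewrite casimir_sum_idem cycle_sum_incident.
by apply: eq_bigr => x _; rewrite vertex_powerE.
Qed.

(** Traces of idempotents are the rows of N^T D N applied to the socle elements, and vertex powers
    are the rows of N; so a relation N = X N^T D N supplies the coefficients. *)
Lemma vertex_power_casimir_sum x : [pchar k] =i pred0 ->
  exists c, vertex_power x = tau c.
Proof.
move=> /(incidence_span_gram (@incidence G) (@mult_gt0 G))[X eqX].
exists (\sum_v X x v *: idem v); rewrite linear_sum vertex_powerE incident_sumE.
under eq_bigr => e _ do rewrite eqX scaler_suml.
rewrite exchange_big; apply: eq_bigr => v _ /=.
rewrite linearZ /= casimir_sum_idemE scaler_sumr.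
under [RHS]eq_bigr => y _ do
  rewrite vertex_powerE incident_sumE scalerA scaler_sumr.
rewrite exchange_big; apply: eq_bigr => e _ /=.
rewrite /weighted_gram natr_sum mulr_sumr scaler_suml; apply: eq_bigr => y _.
by rewrite scalerA -mulrA -natrM.
Qed.

Theorem projective_center_vertex_power z : [pchar k] =i pred0 ->
  projective_center z <->
  exists c : vertex G -> k, z = \sum_x c x *: vertex_power x.
Proof.
move=> char0.
apply: (iff_trans (projective_centerP dual_pairs_expandl dual_pairs_expandr z)).
split=> [[c ->]|[c ->]].
  (* Only the idempotents contribute to the image of the trace map. *)
  elim/spanning_ind: c => [d x y [cx eqx] [cy eqy]|v|a j /andP[j0 _]].
  - exists (fun u => d * cx u + cy u); rewrite linearP /= eqx eqy.
    rewrite scaler_sumr -big_split.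
    by apply: eq_bigr => u _; rewrite /= scalerDl scalerA.
  - by exists (fun x => (mult x * incidence x v)%:R); exact: casimir_sum_idemE.
  - exists (fun=> 0); rewrite casimir_sum_rot_path // big1 // => x _.
    by rewrite scale0r.
elim/big_rec: _ => [|x y _ [d ->]]; first by exists 0; rewrite linear0.
have [e ->] := vertex_power_casimir_sum x char0.
by exists (c x *: e + d); rewrite linearP.
Qed.

End CycleAlgebra.

(** * The symmetrizing form *)

Section PathWords.
Variables (k : fieldType) (Q : quiver).
Local Notation kQ := (path_alg k Q).
Local Notation pm p := (cat_mor k (C := path_cat Q) p : kQ).
Local Notation pid v := (pm (@qid Q v)).
Local Notation arr := (@arrow_elt k Q).
Implicit Types (v w : Q0 Q) (a b : Q1 Q) (s : seq (Q1 Q)) (p q : qpath Q).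

Definition word s : kQ := \prod_(a <- s) arr a.

Lemma word_cons a s : word (a :: s) = arr a * word s.
Proof. exact: big_cons. Qed.

Lemma word_seq1 a : word [:: a] = arr a.
Proof. exact: big_seq1. Qed.

Lemma word_cat s1 s2 : word (s1 ++ s2) = word s1 * word s2.
Proof. exact: big_cat. Qed.

Lemma mor_mul p q : pm p * pm q = cat_omor k (C := path_cat Q) (qcomp p q).
Proof. exact: cat_mul_mor. Qed.

Lemma qid_qid v w : pid v * pid w = if v == w then pid v else 0.
Proof.
by rewrite [LHS]mor_mul qcomp_idl; case: eqP => [->|].
Qed.

Lemma qid_arrow v a : pid v * arr a = if v == tgt a then arr a else 0.
Proof.
by rewrite [LHS]mor_mul qcomp_idl; case: eqP.
Qed.

Lemma arrow_qid a v : arr a * pid v = if v == src a then arr a else 0.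
Proof.
by rewrite [LHS]mor_mul qcomp_idr; case: eqP.
Qed.

Lemma arrow_not_composable a b : src a != tgt b -> arr a * arr b = 0.
Proof.
move=> nab.
by rewrite [LHS]mor_mul /qcomp (negPf nab).
Qed.

Lemma qid_word v s :
  pid v * word s = cat_omor k (C := path_cat Q) (insub (v, s)).
Proof.
elim: s v => [|a s IHs] v.
  by rewrite /word big_nil mulr1 -[(v, _)]/(val (qid v)) valK.
rewrite word_cons mulrA qid_arrow; case: eqP => [->|nva]; last first.
  by rewrite mul0r insubF //=; apply/negbTE/negP => /andP[/eqP/esym].
have := arrow_qid a (src a); rewrite eqxx => <-; rewrite -mulrA IHs.
case: insubP => [p _ valp|np]; last by rewrite mulr0 insubF //= eqxx (negPf np).
have [|r eqr valr] := @qcompP _ (arrow_path a) p.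
  by rewrite [qtgt p](congr1 fst valp).
rewrite [LHS]mor_mul eqr; have -> : (tgt a, a :: s) = val r.
  by rewrite valr [qarrows p](congr1 snd valp).
by rewrite valK.
Qed.

Lemma mor_word p : pm p = pid (qtgt p) * word (qarrows p).
Proof.
by rewrite qid_word -[(_, _)]/((val p).1, (val p).2) -surjective_pairing valK.
Qed.

Lemma word_qid s v : s != [::] ->
  word s * pid v = if v == last v [seq src a | a <- s] then word s else 0.
Proof.
case/lastP: s => // s a _; rewrite map_rcons last_rcons -cats1 word_cat -mulrA.
by rewrite word_seq1 arrow_qid; case: ifP; rewrite ?mulr0.
Qed.

Lemma qid_word_cons v a s :
  pid v * word (a :: s) = if v == tgt a then word (a :: s) else 0.
Proof. by rewrite word_cons mulrA qid_arrow; case: ifP; rewrite ?mul0r. Qed.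

End PathWords.

Section CycleTrace.
Variables (k : fieldType) (G : brauer_graph).
Local Notation Q := (brauer_quiver G).
Local Notation kQ := (path_alg k Q).
Local Notation pm p := (cat_mor k (C := path_cat Q) p : kQ).
Local Notation pid v := (pm (@qid Q v)).
Local Notation arr := (@arrow_elt k Q).
Local Notation wd := (@word k Q).
Local Notation sg := (@sigma G).
Implicit Types (v w : Q0 Q) (a b : arrow G) (s : seq (arrow G)).

Lemma word_cycleX a n :
  arrow_cycle k a ^+ n = wd (traject sg a (fingraph.order sg a * n)).
Proof.
have wordE j b : wd (traject sg b j) = \prod_(i < j) arr (iter i sg b).
  elim: j b => [|j IHj] b; first by rewrite big_ord0 /word big_nil.
  rewrite big_ord_recl trajectS word_cons IHj; congr (_ * _).
  by apply: eq_bigr => i _; rewrite -iterSr.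
elim: n => [|n IHn]; first by rewrite muln0 /word big_nil.
rewrite exprS mulnS trajectD word_cat wordE fingraph.iter_order ?IHn //.
exact: sigma_inj.
Qed.

Lemma word_full_cycle a :
  wd (traject sg a (cycle_len a)) = arrow_cycle k a ^+ cycle_mult a.
Proof. exact/esym/word_cycleX. Qed.

(* Vanishes on the relations, hence induces the symmetrizing form of A_Gamma. *)
Definition cycle_trace (x : kQ) : k^o :=
  lin_ext (fun p : qpath Q => (full_cycle (qarrows p))%:R : k^o) x.
HB.instance Definition _ := GRing.isLinear.Build k kQ k^o _ cycle_trace
  (lin_ext_is_linear (fun p : qpath Q => (full_cycle (qarrows p))%:R : k^o)).

Lemma cycle_trace_qid_word v s :
  cycle_trace (pid v * wd s) = (is_path (Q := Q) v s && full_cycle s)%:R.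
Proof.
rewrite qid_word; case: insubP => [p /= -> valp|/= /negPf ->]; last exact: linear0.
by rewrite [LHS](lin_ext_mor (C := path_cat Q)) [qarrows p](congr1 snd valp).
Qed.

Lemma is_path_traject a j : is_path (Q := Q) (tgt (q := Q) a) (traject sg a j).
Proof.
elim: j a => // j IHj a; apply/andP; split; first exact: eqxx.
by rewrite -tgt_sigma; exact: IHj.
Qed.

Lemma last_src_traject v a j : (0 < j)%N ->
  last v [seq src (q := Q) b | b <- traject sg a j] = tgt (q := Q) (iter j sg a).
Proof. by case: j => // j _; rewrite trajectSr map_rcons last_rcons -tgt_sigma. Qed.

Lemma word_traject_qid a j v : (0 < j)%N ->
  wd (traject sg a j) * pid v =
  if v == tgt (q := Q) (iter j sg a) then wd (traject sg a j) else 0.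
Proof.
move=> j0; rewrite word_qid ?last_src_traject //.
by rewrite -size_eq0 size_traject gtn_eqF.
Qed.

Lemma qid_word_traject a j v : (0 < j)%N ->
  pid v * wd (traject sg a j) =
  if v == tgt (q := Q) a then wd (traject sg a j) else 0.
Proof. by case: j => // j _; exact: qid_word_cons. Qed.

Lemma cycle_trace_traject a j : (0 < j)%N ->
  cycle_trace (wd (traject sg a j)) = (j == cycle_len a)%:R.
Proof.
move=> j0; have := qid_word_traject a (tgt (q := Q) a) j0; rewrite eqxx => <-.
by rewrite cycle_trace_qid_word is_path_traject full_cycle_traject.
Qed.

Lemma cycle_trace_full v w a :
  cycle_trace (pid v * wd (traject sg a (cycle_len a)) * pid w) =
  ((v == tgt (q := Q) a) && (w == tgt (q := Q) a))%:R.
Proof.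
rewrite -mulrA word_traject_qid ?cycle_len_gt0 // iter_cycle_len andbC.
case: eqP => _; last by rewrite mulr0 linear0.
rewrite qid_word_traject ?cycle_len_gt0 //; case: eqP => _; last exact: linear0.
by rewrite cycle_trace_traject ?cycle_len_gt0 // eqxx.
Qed.

(** A relation is tested between two paths p and q. For (a), either both are trivial and the two
    cycles are traced alike, or both products are too long. For (b), the run has one arrow too many.
    For (c), two successive arrows are not related by [sigma]. *)
Lemma cycle_trace_ideal x : gen_ideal (@brauer_rel k G) x -> cycle_trace x = 0.
Proof.
suff tr0 : gen_ideal (@brauer_rel k G) x -> forall y z, cycle_trace (y * x * z) = 0.
  by move/tr0/(_ 1 1); rewrite mul1r mulr1.
have tr_linear (u : kQ) : linear (fun y => cycle_trace (y * u)).
  by move=> c y y'; rewrite mulrDl -scalerAl linearP.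
have tr_linear_r (u : kQ) : linear (fun y => cycle_trace (u * y)).
  by move=> c y y'; rewrite mulrDr -scalerAr linearP.
have linear_0 : linear ((fun=> 0) : kQ -> k^o) by move=> c y z; rewrite scaler0 addr0.
have tr_mor u : (forall p q, cycle_trace (pm p * u * pm q) = 0) ->
    forall y z, cycle_trace (y * u * z) = 0.
  move=> u0 y z; rewrite -mulrA.
  apply: (eq_linear_on_mor (tr_linear (u * z)) linear_0) => p; rewrite mulrA.
  apply: (eq_linear_on_mor (tr_linear_r (pm p * u)) linear_0) => q; exact: u0.
have tr_mid s (p q : qpath Q) : s != [::] ->
    full_cycle (qarrows p ++ s ++ qarrows q) = false ->
    cycle_trace (pm p * wd s * pm q) = 0.
  move=> s0 nfull; rewrite (mor_word k p) (mor_word k q) !mulrA.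
  rewrite -(mulrA _ (wd s)) word_qid //; case: eqP => _; last first.
    by rewrite !(mulr0, mul0r) linear0.
  by rewrite -2!mulrA -!word_cat cycle_trace_qid_word nfull andbF.
elim=> {x} [x|y z|u v _ IHu _ IHv y z|a u _ IHu y z|a u _ IHu y z].
- case=> [a b eq_t y z|a|a b _ nsab].
  + apply: tr_mor => p q; rewrite mulrBr mulrBl linearB /= -!word_full_cycle.
    have [pq0|pq0] := eqVneq (size (qarrows p) + size (qarrows q))%N 0%N; last first.
      have nfull c :
          full_cycle (qarrows p ++ traject sg c (cycle_len c) ++ qarrows q) = false.
        apply/negP => /(full_cycle_mid (cycle_len_gt0 c)) /eqP.
        by rewrite addnAC -[eqbRHS]add0n eqn_add2r (negPf pq0).
      have ne c : traject sg c (cycle_len c) != [::].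
        by rewrite -size_eq0 size_traject gtn_eqF ?cycle_len_gt0.
      by rewrite !tr_mid ?subrr.
    move/eqP: pq0; rewrite addn_eq0 !size_eq0 => /andP[/eqP p0 /eqP q0].
    rewrite (mor_word k p) (mor_word k q) p0 q0 /word big_nil !mulr1.
    by rewrite !cycle_trace_full eq_t subrr.
  + have <- : cycle_mult (sigma a) = cycle_mult a.
      by rewrite /cycle_mult (base_iter_sigma 1).
    rewrite -word_full_cycle.
    have -> : arr a * wd (traject sg (sigma a) (cycle_len (sigma a))) =
      wd (traject sg a (cycle_len a).+1).
      by rewrite trajectS word_cons (cycle_len_iter 1).
    apply: tr_mor => p q; apply: tr_mid => //; apply/negP.
    move=> /(full_cycle_mid (ltn0Sn _)) /eqP.
    by rewrite addnS addSn gtn_eqF // ltnS addnAC leq_addl.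
  + have -> : arr a * arr b = wd [:: a; b].
      by rewrite !word_cons /word big_nil mulr1.
    apply: tr_mor => p q; apply: tr_mid => //; apply/negP => /full_cycle_succ eqb.
    by rewrite eqb eqxx in nsab.
- by rewrite mulr0 mul0r linear0.
- by rewrite mulrBr mulrBl linearB /= IHu IHv subrr.
- by rewrite mulrA IHu.
- by rewrite mulrA -mulrA IHu.
Qed.

End CycleTrace.

(** * Multiplication rules and a spanning set of the Brauer graph algebra *)

Section BrauerBasis.
Variables (k : fieldType) (G : brauer_graph).
Local Notation Q := (brauer_quiver G).
Local Notation A := (brauer_alg k G).
Local Notation kQ := (path_alg k Q).
Local Notation pm p := (cat_mor k (C := path_cat Q) p : kQ).
Local Notation pid v := (pm (@qid Q v)).
Local Notation wd := (@word k Q).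
Local Notation arr := (@arrow_elt k Q).
Local Notation sg := (@sigma G).
Local Notation tgt := (@tgt Q).
Local Notation src := (@src Q).
Local Notation pi := (@brauer_pi k G).
Local Notation socle := (@socle_elt k G).
Implicit Types (v w e : edge G) (a b : arrow G) (i j : nat).

Lemma brauer_piM x y : pi (x * y) = pi x * pi y.
Proof. exact: ideal_piM. Qed.

Lemma brauer_pi_linear : linear pi.
Proof.
move=> c x y.
have piD : pi (c *: x + y) = pi (c *: x) + pi y by exact: ideal_piD.
have piZ : pi (c *: x) = c *: pi x by exact: ideal_piZ.
exact: (etrans piD (congr1 (fun z : A => z + pi y) piZ)).
Qed.
HB.instance Definition _ := GRing.isLinear.Build k kQ A _ pi brauer_pi_linear.

Lemma brauer_pi0 x : brauer_rel x -> pi x = 0.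
Proof.
move=> rel_x; transitivity (pi 0); last exact: linear0.
by apply/ideal_piP; rewrite subr0; exact: gen_ideal_base.
Qed.

Definition idem e : A := pi (pid e).
Definition rot_path a j : A := pi (wd (traject sg a j)).
Definition brauer_trace (x : A) : k^o := cycle_trace (ideal_repr x).

Lemma brauer_trace_pi x : brauer_trace (pi x) = cycle_trace x.
Proof.
have := cycle_trace_ideal (gen_ideal_repr (@brauer_rel k G) x).
by rewrite linearB => /eqP; rewrite subr_eq0 => /eqP.
Qed.

Lemma brauer_trace_is_linear : linear brauer_trace.
Proof.
move=> c x y; rewrite -[x]ideal_reprK -[y]ideal_reprK -!/(pi _).
by rewrite -linearP !brauer_trace_pi linearP.
Qed.
HB.instance Definition _ :=
  GRing.isLinear.Build k A k^o _ brauer_trace brauer_trace_is_linear.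

Lemma arrow_mul0 a b : b != sg a -> pi (arr a * arr b) = 0.
Proof.
move=> nab; have [eqab|neq] := eqVneq (src a) (tgt b).
  exact/brauer_pi0/brauer_rel_c.
by rewrite arrow_not_composable // linear0.
Qed.

Lemma rot_pathM a i b j : (0 < i)%N -> (0 < j)%N ->
  rot_path a i * rot_path b j =
  if b == iter i sg a then rot_path a (i + j) else 0.
Proof.
move=> i0 j0; rewrite -brauer_piM; case: eqP => [->|/eqP].
  by rewrite -word_cat -trajectD.
case: i i0 => // i _; case: j j0 => // j _ nab.
rewrite trajectSr -cats1 word_cat word_seq1 trajectS word_cons.
rewrite -mulrA (mulrA (arr _)) !brauer_piM -(brauer_piM (arr _)) arrow_mul0 //.
by rewrite mul0r mulr0.
Qed.

Lemma rot_path_cycle_len a : rot_path a (cycle_len a) = socle (tgt a).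
Proof. by rewrite socle_eltE /rot_path word_full_cycle brauer_piX. Qed.

(** The first [cycle_len a + 1] arrows form relation (b). *)
Lemma rot_path_gt a j : (cycle_len a < j)%N -> rot_path a j = 0.
Proof.
move=> lt_j; have -> : j = ((cycle_len a).+1 + (j - (cycle_len a).+1))%N.
  by rewrite subnKC.
rewrite /rot_path trajectD word_cat brauer_piM.
rewrite trajectS word_cons -(cycle_len_iter 1) word_full_cycle.
have -> : cycle_mult (iter 1 sg a) = cycle_mult a.
  by rewrite /cycle_mult base_iter_sigma.
have := brauer_pi0 (brauer_rel_b k a); rewrite -[sigma a]/(iter 1 sg a) => ->.
by rewrite mul0r.
Qed.

Lemma idemM e e' : idem e * idem e' = if e == e' then idem e else 0.
Proof. by rewrite -brauer_piM qid_qid; case: eqP => // _; exact: linear0. Qed.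

Lemma idem_rot_path e a j : (0 < j)%N ->
  idem e * rot_path a j = if e == tgt a then rot_path a j else 0.
Proof.
move=> j0; rewrite -brauer_piM qid_word_traject //.
by case: ifP => // _; exact: linear0.
Qed.

Lemma rot_path_idem e a j : (0 < j)%N ->
  rot_path a j * idem e = if e == tgt (iter j sg a) then rot_path a j else 0.
Proof.
move=> j0; rewrite -brauer_piM word_traject_qid //.
by case: ifP => // _; exact: linear0.
Qed.

Lemma brauer_trace_idem e : brauer_trace (idem e) = 0.
Proof.
rewrite brauer_trace_pi; have := cycle_trace_qid_word k e [::].
by rewrite /word big_nil mulr1.
Qed.

Lemma brauer_trace_rot_path a j : (0 < j)%N ->
  brauer_trace (rot_path a j) = (j == cycle_len a)%:R.
Proof. by move=> j0; rewrite brauer_trace_pi cycle_trace_traject. Qed.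

(** Relation (c) kills every word in which some arrow is not followed by its [sigma]-image. *)
Lemma brauer_pi_word (v : edge G) s : is_path (Q := Q) v s -> s != [::] ->
  pi (wd s) = 0 \/ exists a, pi (wd s) = rot_path a (size s).
Proof.
elim: s v => // a [|b s] IHs v /= /andP[_ path_s] _.
  by right; exists a; rewrite /rot_path.
have [s0|[c sc]] := IHs _ path_s isT.
  by left; rewrite word_cons brauer_piM s0 mulr0.
have := rot_pathM a c (ltn0Sn 0) (ltn0Sn (size s)).
rewrite -[rot_path c _]sc -brauer_piM /= word_seq1 -word_cons => ->.
by case: eqP => _; [right; exists a|left].
Qed.

(** Paths span the path algebra; modulo the relations a nontrivial path is 0 or a run of [sigma],
    and runs beyond a full cycle vanish. *)
Lemma brauer_alg_ind (P : A -> Prop) :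
  (forall c x y, P x -> P y -> P (c *: x + y)) ->
  (forall e, P (idem e)) ->
  (forall a j, (0 < j <= cycle_len a)%N -> P (rot_path a j)) ->
  forall x, P x.
Proof.
move=> Plin Pidem Ppath x.
have /card_gt0P[e0 _] := edge_inh G.
have P0 : P 0 by have := Plin (-1) _ _ (Pidem e0) (Pidem e0); rewrite scaleN1r addNr.
have Pmor (p : qpath Q) : P (pi (pm p)).
  rewrite mor_word; case: p => -[v s] /= path_s; rewrite /qtgt /qarrows /=.
  have [->|s0] := eqVneq s [::]; first by rewrite /word big_nil mulr1; exact: Pidem.
  case: s s0 path_s => // a s _ path_s; rewrite qid_word_cons.
  case: eqP => _; last by rewrite linear0.
  have [->//|[b ->]] := brauer_pi_word path_s isT.
  have [le_b|gt_b] := leqP (size (a :: s)) (cycle_len b); first exact: Ppath.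
  by rewrite rot_path_gt.
rewrite -[x]ideal_reprK -/(pi _); move: (ideal_repr x) => u.
rewrite [u]monalg.monalgE linear_sum.
elim/big_rec: _ => // p y _ Py.
rewrite malgUZ linearZ; apply: Plin => //.
by have := Pmor p; rewrite cat_mor.unlock.
Qed.

End BrauerBasis.

(** * Return to the elements of the statement *)

Lemma cycle_eltE (k : fieldType) (G : brauer_graph) (a : arrow G) :
  cycle_elt k a = rot_path k a (fingraph.order (@sigma G) a).
Proof.
by rewrite /cycle_elt /rot_path -[arrow_cycle k a]expr1 word_cycleX muln1.
Qed.

Lemma vertex_power_elt (k : fieldType) (G : brauer_graph) (x : vertex G) :
  vertex_power (@socle_elt k G) (@rot_path k G) x = vertex_elt k x.
Proof.
rewrite /vertex_power /vertex_elt; case: (truncated x); first reflexivity.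
have -> : vertex_cycles k x = \sum_(a : arrow G | base (val a) == x)
    rot_path k a (fingraph.order (@sigma G) a).
  by apply: eq_bigr => a _; exact: cycle_eltE.
reflexivity.
Qed.

Unset Implicit Arguments.
Theorem lemma3p3 (k : closedFieldType) (char0 : [pchar k] =i pred0)
    (G : brauer_graph) (z : brauer_alg k G) :
  projective_center z <->
  exists c : vertex G -> k, z = \sum_(x : vertex G) c x *: vertex_elt k x.
Proof.
have := @projective_center_vertex_power k G (brauer_alg k G) _ _ _ (@brauer_trace k G)
  (@idemM k G) (@idem_rot_path k G) (@rot_path_idem k G) (@rot_pathM k G)
  (@rot_path_gt k G) (@rot_path_cycle_len k G) (@brauer_trace_idem k G)
  (@brauer_trace_rot_path k G) (@brauer_alg_ind k G) z char0.
move=> main; apply: (iff_trans main).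
split=> -[c ->]; exists c; apply: eq_bigr => x _; rewrite vertex_power_elt; reflexivity.
Qed.
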